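(* Let $r\ge 2$, $k\ge 4$, and let $G$ be either the free metabelian group $M_r$ of rank $r$ or the free metabelian nilpotent group $M_{rk}$ of rank $r$ and nilpotency class $k$. Let $H=\langle g,f\rangle$ be a two-generated subgroup of $G$. Then the following are equivalent: (1) $H$ is a retract of $G$; (2) $H$ is algebraically closed in $G$; (3) $H$ is verbally closed in $G$.
   Context: $M_r$ is the free group of rank $r$ in the variety of metabelian groups; $M_{rk}$ is the free group of rank $r$ in the variety of metabelian groups that are nilpotent of class at most $k$. A subgroup $H$ of $G$ is a retract if there is a homomorphism $G\to H$ restricting to the identity on $H$. $H$ is algebraically closed in $G$ if every finite system of equations $E_i(x_1,\dots,x_n,H)=1$ ($i=1,\dots,m$) with constants from $H$ that has a solution in $G$ also has a solution in $H$. Let $F(X)$ be the free group on a countably infinite set $X=\{x_1,x_2,\dots\}$; $H$ is verbally closed in $G$ if for every $w=w(x_1,\dots,x_n)\in F(X)$ and every $h\in H$, the equation $w(x_1,\dots,x_n)=h$ has a solution in $G$ if and only if it has a solution in $H$. *)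

(* Defs.v *)
From Stdlib Require Import List Arith.

(* A group: carrier with multiplication, identity and inverse
   (left identity and left inverse axioms suffice). *)
Record group := Group {
  carrier :> Type;
  gmul : carrier -> carrier -> carrier;
  gone : carrier;
  ginv : carrier -> carrier;
  gmulA : forall a b c, gmul a (gmul b c) = gmul (gmul a b) c;
  gmul1 : forall a, gmul gone a = a;
  gmulV : forall a, gmul (ginv a) a = gone
}.

Arguments gmul {g}. Arguments gone {g}. Arguments ginv {g}.

Definition comm {G : group} (a b : G) : G :=
  gmul (gmul (ginv a) (ginv b)) (gmul a b).

Fixpoint lcomm {G : group} (s : nat -> G) (n : nat) : G :=
  match n with
  | 0 => s 0
  | S m => comm (lcomm s m) (s (S m))
  end.

Definition metabelian (G : group) : Prop :=
  forall a b c d : G, comm (comm a b) (comm c d) = gone.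

(* Variety of nilpotent groups of class at most k: law [x1,...,x_{k+1}] = 1. *)
Definition nilpotent_le (k : nat) (G : group) : Prop :=
  forall s : nat -> G, lcomm s k = gone.

Definition is_hom {G M : group} (phi : G -> M) : Prop :=
  forall a b : G, phi (gmul a b) = gmul (phi a) (phi b).

(* Group terms in variables x_0, x_1, ... with constants from C.
   Terms with C = Empty_set represent words of the free group F(X). *)
Inductive term (C : Type) : Type :=
  | TVar : nat -> term C
  | TCst : C -> term C
  | TOne : term C
  | TMul : term C -> term C -> term C
  | TInv : term C -> term C.
Arguments TVar {C}. Arguments TCst {C}. Arguments TOne {C}.
Arguments TMul {C}. Arguments TInv {C}.

Fixpoint eval {G : group} {C : Type} (c : C -> G) (a : nat -> G) (t : term C) : G :=
  match t with
  | TVar n => a n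
  | TCst x => c x
  | TOne => gone
  | TMul t1 t2 => gmul (eval c a t1) (eval c a t2)
  | TInv t1 => ginv (eval c a t1)
  end.

Definition weval {G : group} (a : nat -> G) (w : term Empty_set) : G :=
  eval (fun e : Empty_set => match e return G with end) a w.

Fixpoint consts_in {G : group} (H : G -> Prop) (t : term G) : Prop :=
  match t with
  | TVar _ | TOne => True
  | TCst x => H x
  | TMul t1 t2 => consts_in H t1 /\ consts_in H t2
  | TInv t1 => consts_in H t1
  end.

(* G is relatively free of rank r in the variety V with basis x_0..x_{r-1}:
   G lies in V, is generated by the x_i, and every map of the basis into a
   group of V extends to a homomorphism (unique, by generation). *)
Definition basis_assign {G : group} (r : nat) (x : nat -> G) : nat -> G :=
  fun n => if n <? r then x n else gone.

Definition rel_free (V : group -> Prop) (r : nat) (G : group) (x : nat -> G) : Prop :=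
  V G /\
  (forall g : G, exists w : term Empty_set, weval (basis_assign r x) w = g) /\
  (forall M : group, V M -> forall y : nat -> M,
     exists phi : G -> M, is_hom phi /\ forall i, i < r -> phi (x i) = y i).

Definition gen2 {G : group} (g f : G) : G -> Prop :=
  fun h => exists w : term Empty_set,
    weval (fun n => match n with 0 => g | 1 => f | _ => gone end) w = h.

Definition retract {G : group} (H : G -> Prop) : Prop :=
  exists phi : G -> G, is_hom phi /\ (forall a, H (phi a)) /\ (forall h, H h -> phi h = h).

Definition alg_closed {G : group} (H : G -> Prop) : Prop :=
  forall sys : list (term G),
    Forall (consts_in H) sys ->
    (exists a : nat -> G, Forall (fun E => eval id a E = gone) sys) ->
    exists a : nat -> G, (forall n, H (a n)) /\ Forall (fun E => eval id a E = gone) sys.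

Definition verb_closed {G : group} (H : G -> Prop) : Prop :=
  forall (w : term Empty_set) (h : G), H h ->
    ((exists a : nat -> G, weval a w = h) <->
     (exists a : nat -> G, (forall n, H (a n)) /\ weval a w = h)).

(* Main.v *)
(** A verbally closed H = <g,f> admits, for each h in H, a homomorphism G -> H fixing h.  If
    the images of g and f in G/G' are dependent, H is generated by some t modulo H', so that
    H' = [H',H]; this forces H' = 1 by nilpotency, or because G' is torsion-free over the
    group ring Z[G/G'] while H' is killed by an element of augmentation 1.  Then H = <t> and
    a homomorphism fixing t is a retraction.

    If they are independent, a homomorphism phi : G -> H fixing [g,f] acts on H/H' with
    determinant 1, as one sees in the Heisenberg group.  In the free metabelian case H' is
    the Z[H/H']-module generated by [g,f], which is free by torsion-freeness, so phi restricts
    to an automorphism of H; in the nilpotent case phi can be corrected to act trivially on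
    H/H', hence unipotently on H.  Composing with the inverse gives a retraction.

    Torsion-freeness comes from the Magnus embedding: an element of G' is determined by the
    1-chain on the Cayley graph of Z^r traced by any word representing it. *)

From Stdlib Require Import List Arith ZArith Lia Classical ClassicalEpsilon.
From Stdlib Require Import FunctionalExtensionality.
Require Import Defs.
Import ListNotations.

Infix "**" := gmul (at level 40, left associativity).
Notation "a ^-1" := (ginv a) (at level 2, left associativity, format "a ^-1").

(** * Groups, homomorphisms, subgroups *)

Section Groups.
Context {G : group}.
Implicit Types a b c h : G.

Lemma mulgV a : a ** a^-1 = gone.
Proof.
rewrite <- (gmul1 G (a ** a^-1)), <- (gmulV G (a^-1)) at 1.
rewrite <- gmulA, (gmulA G (a^-1)), gmulV, gmul1, gmulV; reflexivity.
Qed.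

Lemma mulg1 a : a ** gone = a.
Proof. rewrite <- (gmulV G a), gmulA, mulgV, gmul1; reflexivity. Qed.

Lemma mulKg a b : a^-1 ** (a ** b) = b.
Proof. rewrite gmulA, gmulV, gmul1; reflexivity. Qed.

Lemma mulVKg a b : a ** (a^-1 ** b) = b.
Proof. rewrite gmulA, mulgV, gmul1; reflexivity. Qed.

Lemma invg_unique a b : a ** b = gone -> b = a^-1.
Proof. intros e; rewrite <- (mulKg a b), e, mulg1; reflexivity. Qed.

Lemma invg1 : (gone : G)^-1 = gone.
Proof. symmetry; apply invg_unique, gmul1. Qed.

Lemma invgK a : a^-1^-1 = a.
Proof. symmetry; apply invg_unique, gmulV. Qed.

Lemma invMg a b : (a ** b)^-1 = b^-1 ** a^-1.
Proof.
symmetry; apply invg_unique.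
rewrite <- gmulA, mulVKg, mulgV; reflexivity.
Qed.

Lemma mulgA_r a b c : (a ** b) ** c = a ** (b ** c).
Proof. symmetry; apply gmulA. Qed.

End Groups.

#[global] Hint Rewrite @mulgA_r @invMg @invgK @invg1 @mulg1 @gmul1 @gmulV @mulgV
  @mulKg @mulVKg : grp.

Ltac grp := intros; unfold comm; autorewrite with grp; try reflexivity.

(** Conjugation is written on the left so that it is a left action; it makes the derived subgroup of
    a metabelian group a left module over the group ring. *)
Definition conjg {G : group} (h c : G) : G := h ** c ** h^-1.

Section Commutators.
Context {G : group}.
Implicit Types a b c h z : G.

Lemma mulg_eq1 a b : a ** b^-1 = gone -> a = b.
Proof. intros e; rewrite <- (mulg1 a), <- (gmulV G b), gmulA, e, gmul1; reflexivity. Qed.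

Lemma mulgI h a b : h ** a = h ** b -> a = b.
Proof. intros e; rewrite <- (mulKg h a), e, mulKg; reflexivity. Qed.

Lemma commMg a b z : comm (a ** b) z = conjg (b^-1) (comm a z) ** comm b z.
Proof. unfold conjg; grp. Qed.

Lemma commgM a b z : comm z (a ** b) = comm z b ** conjg (b^-1) (comm z a).
Proof. unfold conjg; grp. Qed.

Lemma invg_comm a b : (comm a b)^-1 = comm b a.
Proof. grp. Qed.

Lemma conjMg h a b : conjg h (a ** b) = conjg h a ** conjg h b.
Proof. unfold conjg; grp. Qed.

Lemma conjVg h a : conjg h (a^-1) = (conjg h a)^-1.
Proof. unfold conjg; grp. Qed.

Lemma conjg1 h : conjg h gone = gone.
Proof. unfold conjg; grp. Qed.

Lemma conjgM h b a : conjg (h ** b) a = conjg h (conjg b a).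
Proof. unfold conjg; grp. Qed.

Lemma conjg_comm h a b : conjg h (comm a b) = comm (conjg h a) (conjg h b).
Proof. unfold conjg; grp. Qed.

Lemma comm_eq1 a b : comm a b = gone -> a ** b = b ** a.
Proof.
intros e; apply invg_unique in e; rewrite e; grp.
Qed.

Lemma commute_comm a b : a ** b = b ** a -> comm a b = gone.
Proof. intros e; unfold comm; rewrite e; grp. Qed.

Lemma commute_conj a b : a ** b = b ** a -> conjg a b = b.
Proof. intros e; unfold conjg; rewrite e; grp. Qed.

Lemma commute_inv a b : a ** b = b ** a -> a ** b^-1 = b^-1 ** a.
Proof.
intros e; apply (mulgI b); rewrite mulVKg, gmulA, <- e; grp.
Qed.

End Commutators.

Section Homs.
Context {G M : group} (phi : G -> M) (phiM : is_hom phi).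

Lemma hom1 : phi gone = gone.
Proof. apply (mulgI (phi gone)); rewrite <- phiM, !mulg1; reflexivity. Qed.

Lemma homV a : phi (a^-1) = (phi a)^-1.
Proof. apply invg_unique; rewrite <- phiM, mulgV; apply hom1. Qed.

Lemma hom_comm a b : phi (comm a b) = comm (phi a) (phi b).
Proof. unfold comm; rewrite !phiM, !homV; reflexivity. Qed.

Lemma hom_conj a b : phi (conjg a b) = conjg (phi a) (phi b).
Proof. unfold conjg; rewrite !phiM, !homV; reflexivity. Qed.

Lemma hom_weval (a : nat -> G) w : phi (weval a w) = weval (fun n => phi (a n)) w.
Proof.
induction w as [n|[]| |w1 IH1 w2 IH2|w IH]; simpl.
- reflexivity.
- apply hom1.
- unfold weval in *; simpl; rewrite phiM, IH1, IH2; reflexivity.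
- unfold weval in *; simpl; rewrite homV, IH; reflexivity.
Qed.

End Homs.

Lemma weval_ext {G : group} (a b : nat -> G) w : (forall n, a n = b n) -> weval a w = weval b w.
Proof. intros e; replace b with a by (extensionality n; apply e); reflexivity. Qed.

(** * Subgroups, generation and the lower central series *)

Record subgroup {G : group} (K : G -> Prop) : Prop := {
  sub1 : K gone;
  subM : forall a b, K a -> K b -> K (a ** b);
  subV : forall a, K a -> K (a^-1) }.

Inductive gen {G : group} (S : G -> Prop) : G -> Prop :=
  | gen_in a : S a -> gen S a
  | gen_one : gen S gone
  | gen_mul a b : gen S a -> gen S b -> gen S (a ** b)
  | gen_inv a : gen S a -> gen S (a^-1).

Section Subgroups.
Context {G : group}.

Lemma gen_subgroup (S : G -> Prop) : subgroup (gen S).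
Proof. split; [apply gen_one|apply gen_mul|apply gen_inv]. Qed.

Lemma gen_min (S K : G -> Prop) : subgroup K -> (forall a, S a -> K a) -> forall a, gen S a -> K a.
Proof.
intros sK SK a; induction 1; auto; [apply sub1|apply subM|apply subV]; assumption.
Qed.

Lemma weval_sub (K : G -> Prop) a w : subgroup K -> (forall n, K (a n)) -> K (weval a w).
Proof.
intros sK aK; induction w as [n|[]| |w1 IH1 w2 IH2|w IH].
- apply aK.
- apply (sub1 K sK).
- apply (subM K sK); assumption.
- apply (subV K sK); assumption.
Qed.

Lemma sub_conj (K : G -> Prop) : subgroup K -> forall h a, K h -> K a -> K (conjg h a).
Proof. intros sK h a Kh Ka; unfold conjg; apply subM; auto; [apply subM|apply subV]; auto. Qed.

Lemma sub_comm (K : G -> Prop) : subgroup K -> forall h a, K h -> K a -> K (comm h a).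
Proof. intros sK h a Kh Ka; unfold comm; repeat apply subM; auto; apply subV; auto. Qed.

Lemma gen_normal (K S : G -> Prop) :
  (forall h a, K h -> S a -> S (conjg h a)) ->
  forall h a, K h -> gen S a -> gen S (conjg h a).
Proof.
intros SK h a Kh; induction 1.
- apply gen_in; auto.
- rewrite conjg1; apply gen_one.
- rewrite conjMg; apply gen_mul; auto.
- rewrite conjVg; apply gen_inv; auto.
Qed.

Definition mutual_comm (K L : G -> Prop) : G -> Prop :=
  gen (fun z => exists a b, K a /\ L b /\ z = comm a b).

Lemma mutual_comm_in (K L : G -> Prop) a b : K a -> L b -> mutual_comm K L (comm a b).
Proof. intros; apply gen_in; eauto. Qed.

Lemma mutual_comm_normal (K L : G -> Prop) :
  subgroup L -> (forall h a, L h -> K a -> K (conjg h a)) ->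
  forall h a, L h -> mutual_comm K L a -> mutual_comm K L (conjg h a).
Proof.
intros sL nK; apply gen_normal; intros h _ Lh (a & b & Ka & Lb & ->).
exists (conjg h a), (conjg h b); rewrite conjg_comm; repeat split; auto.
apply sub_conj; auto.
Qed.

(** The index is shifted by one against the usual gamma notation: [lcs K 0] is K itself and
    [lcs K 1] is K'. *)
Fixpoint lcs (K : G -> Prop) (j : nat) : G -> Prop :=
  match j with 0 => K | S i => mutual_comm (lcs K i) K end.

Lemma lcs_normal K j : subgroup K -> forall h a, K h -> lcs K j a -> lcs K j (conjg h a).
Proof.
intros sK; induction j; simpl; intros h a Kh; [apply sub_conj; auto|].
apply mutual_comm_normal; auto.
Qed.

Lemma lcs_sub K j : subgroup K -> forall a, lcs K j a -> K a.
Proof.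
intros sK; induction j; simpl; auto.
apply gen_min; auto; intros _ (a & b & Ka & Kb & ->); apply sub_comm; auto.
Qed.

End Subgroups.

(** * Integer powers and products of powers *)

Fixpoint npow {G : group} (a : G) (n : nat) : G :=
  match n with 0 => gone | S m => npow a m ** a end.

Definition zpow {G : group} (a : G) (n : Z) : G :=
  if (0 <=? n)%Z then npow a (Z.to_nat n) else (npow a (Z.to_nat (- n)))^-1.

Section Powers.
Context {G : group}.
Implicit Types a b h : G.

Lemma npowS_l a n : npow a (S n) = a ** npow a n.
Proof.
induction n; [simpl; grp|].
change (npow a (S (S n))) with (npow a (S n) ** a); rewrite IHn at 1; simpl; grp.
Qed.

Lemma zpow0 a : zpow a 0 = gone.
Proof. reflexivity. Qed.

Lemma zpow_succ a n : zpow a (n + 1) = zpow a n ** a.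
Proof.
unfold zpow; destruct (Z.leb_spec 0 n).
- destruct (Z.leb_spec 0 (n + 1)); [|lia].
  replace (Z.to_nat (n + 1)) with (S (Z.to_nat n)) by lia; reflexivity.
- replace (Z.to_nat (- n)) with (S (Z.to_nat (- (n + 1)))) by lia.
  rewrite npowS_l; destruct (Z.leb_spec 0 (n + 1)).
  + replace (n + 1)%Z with 0%Z by lia; simpl; grp.
  + grp.
Qed.

Lemma zpow_pred a n : zpow a (n - 1) = zpow a n ** a^-1.
Proof.
replace n with (n - 1 + 1)%Z at 2 by lia; rewrite zpow_succ; grp.
Qed.

Lemma zpow1 a : zpow a 1 = a.
Proof. apply gmul1. Qed.

Lemma zpowD a m n : zpow a (m + n) = zpow a m ** zpow a n.
Proof.
induction n as [|n IH|n IH] using Z.peano_ind.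
- rewrite Z.add_0_r, zpow0, mulg1; reflexivity.
- rewrite Z.add_succ_r, <- !Z.add_1_r, !zpow_succ, IH; grp.
- rewrite Z.add_pred_r, <- !Z.sub_1_r, !zpow_pred, IH; grp.
Qed.

Lemma zpowN a n : zpow a (- n) = (zpow a n)^-1.
Proof. apply invg_unique; rewrite <- zpowD, Z.add_opp_diag_r; reflexivity. Qed.

Lemma zpow_sub (K : G -> Prop) a n : subgroup K -> K a -> K (zpow a n).
Proof.
intros sK Ka; induction n as [|n IH|n IH] using Z.peano_ind.
- apply (sub1 K sK).
- rewrite <- Z.add_1_r, zpow_succ; apply subM; auto.
- rewrite <- Z.sub_1_r, zpow_pred; apply subM; auto; apply subV; auto.
Qed.

End Powers.

Lemma hom_zpow {G M : group} (phi : G -> M) a n : is_hom phi -> phi (zpow a n) = zpow (phi a) n.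
Proof.
intros hphi; induction n as [|n IH|n IH] using Z.peano_ind.
- apply hom1; auto.
- rewrite <- Z.add_1_r, !zpow_succ, hphi, IH; reflexivity.
- rewrite <- Z.sub_1_r, !zpow_pred, hphi, IH, homV; auto.
Qed.


(** Keys will mostly be vectors, that is functions [nat -> Z], so their equality is decided
    classically. *)
Definition eqdec {Y : Type} (a b : Y) : {a = b} + {a <> b} := excluded_middle_informative (a = b).

(** * Formal integer combinations and their values in abelian subgroups *)

Section WeightedLists.
Context {X Y : Type}.
Implicit Types l : list (Z * X).

(** A weighted list is an unreduced formal sum, an element of a group ring when X is a group. [key]
    tells which entries count as equal, and [wsum] is the augmentation. *)
Fixpoint lprod {G : group} (d : X -> G) l : G :=
  match l with [] => gone | (e, y) :: l' => zpow (d y) e ** lprod d l' end.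

Fixpoint coef (key : X -> Y) l (a : Y) : Z :=
  match l with [] => 0 | (e, y) :: l' => (if eqdec (key y) a then e else 0) + coef key l' a end.

Fixpoint wsum l : Z := match l with [] => 0 | (e, _) :: l' => e + wsum l' end.

Definition nlist l : list (Z * X) := map (fun p => (- fst p, snd p)%Z) l.

Fixpoint drop_key (key : X -> Y) (a : Y) l : list (Z * X) :=
  match l with
  | [] => []
  | (e, y) :: l' => if eqdec (key y) a then drop_key key a l' else (e, y) :: drop_key key a l'
  end.

Lemma lprod_app {G : group} (d : X -> G) l l' : lprod d (l ++ l') = lprod d l ** lprod d l'.
Proof. induction l as [|[e y] l IH]; simpl; [|rewrite IH]; grp. Qed.

Lemma coef_app key l l' a : coef key (l ++ l') a = (coef key l a + coef key l' a)%Z.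
Proof. induction l as [|[e y] l IH]; simpl; [|rewrite IH]; lia. Qed.

Lemma wsum_app l l' : wsum (l ++ l') = (wsum l + wsum l')%Z.
Proof. induction l as [|[e y] l IH]; simpl; [|rewrite IH]; lia. Qed.

Lemma coef_nlist key l a : coef key (nlist l) a = (- coef key l a)%Z.
Proof. induction l as [|[e y] l IH]; simpl; [|rewrite IH; destruct eqdec]; lia. Qed.

Lemma wsum_nlist l : wsum (nlist l) = (- wsum l)%Z.
Proof. induction l as [|[e y] l IH]; simpl; [|rewrite IH]; lia. Qed.

Lemma drop_key_incl key a l : incl (drop_key key a l) l.
Proof.
induction l as [|[e y] l IH]; simpl; [apply incl_refl|].
destruct eqdec; [apply incl_tl; auto|apply incl_cons; [left; auto|apply incl_tl; auto]].
Qed.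

Lemma drop_key_length key a l : length (drop_key key a l) <= length l.
Proof. induction l as [|[e y] l IH]; simpl; [|destruct eqdec; simpl]; lia. Qed.

Lemma drop_key_neq key a l e y : In (e, y) (drop_key key a l) -> key y <> a.
Proof.
induction l as [|[e' y'] l IH]; simpl; [tauto|].
destruct eqdec; simpl; auto; intros [E|]; auto; congruence.
Qed.

Lemma coef_drop_same key a l : coef key (drop_key key a l) a = 0%Z.
Proof.
induction l as [|[e y] l IH]; simpl; auto.
destruct (eqdec (key y) a) eqn:E; simpl; auto; rewrite E; auto.
Qed.

Lemma coef_drop_other key a b l : a <> b -> coef key (drop_key key a l) b = coef key l b.
Proof.
intros ab; induction l as [|[e y] l IH]; simpl; auto.
destruct (eqdec (key y) a); simpl; rewrite IH; auto.
destruct (eqdec (key y) b); [congruence|lia].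
Qed.

Lemma hom_lprod {G M : group} (phi : G -> M) (d : X -> G) l :
  is_hom phi -> phi (lprod d l) = lprod (fun y => phi (d y)) l.
Proof.
intros hphi; induction l as [|[e y] l IH]; simpl; [apply hom1; auto|].
rewrite hphi, IH, hom_zpow; auto.
Qed.

Lemma lprod_ext {G : group} (d d' : X -> G) l :
  (forall e y, In (e, y) l -> d y = d' y) -> lprod d l = lprod d' l.
Proof.
induction l as [|[e y] l IH]; simpl; auto; intros E.
rewrite (E e y), IH; auto; intros; apply (E e0); auto.
Qed.

Lemma lprod_sub {G : group} (K : G -> Prop) (d : X -> G) l :
  subgroup K -> (forall e y, In (e, y) l -> K (d y)) -> K (lprod d l).
Proof.
intros sK; induction l as [|[e y] l IH]; simpl; intros Kd; [apply (sub1 K sK)|].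
apply subM; auto; [apply zpow_sub; eauto|apply IH; eauto].
Qed.

Section Abelian.
Context {G : group} (A : G -> Prop) (sA : subgroup A).
Hypothesis AC : forall a b, A a -> A b -> a ** b = b ** a.

Lemma lprod_nlist (d : X -> G) l :
  (forall e y, In (e, y) l -> A (d y)) -> lprod d (nlist l) = (lprod d l)^-1.
Proof.
induction l as [|[e y] l IH]; simpl; intros Ad; [grp|].
rewrite IH, invMg, zpowN by eauto; apply AC; apply subV; auto.
- apply zpow_sub; eauto.
- apply lprod_sub; eauto.
Qed.

Lemma lprod_split (d : X -> G) key l y0 :
  A (d y0) -> (forall e y, In (e, y) l -> A (d y) /\ (key y = key y0 -> d y = d y0)) ->
  lprod d l = zpow (d y0) (coef key l (key y0)) ** lprod d (drop_key key (key y0) l).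
Proof.
intros A0; induction l as [|[e y] l IH]; simpl; intros Ad; [rewrite zpow0; grp|].
rewrite IH by eauto; destruct (Ad e y) as [Ay Ey]; auto.
destruct eqdec as [E|E]; simpl.
- rewrite Ey, zpowD; auto; grp.
- rewrite !gmulA; f_equal; apply AC; apply zpow_sub; auto.
Qed.

(** The entries sharing the key of the head gather into one power with exponent 0, and a shorter
    list remains. Several entries may go at once, so the induction is on a bound for the length. *)
Lemma lprod_coef0 (d : X -> G) key l :
  (forall e y, In (e, y) l -> A (d y)) ->
  (forall e y e' y', In (e, y) l -> In (e', y') l -> key y = key y' -> d y = d y') ->
  (forall a, coef key l a = 0%Z) -> lprod d l = gone.
Proof.
remember (length l) as n eqn:En; assert (Hn : length l <= n) by lia; clear En.
revert l Hn; induction n; intros l Hn Ad Ed c0.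
- destruct l; simpl in *; [auto|lia].
- destruct l as [|[e y] l]; auto; simpl in Hn.
  rewrite (lprod_split d key _ y), c0, zpow0, gmul1.
  + apply IHn.
    * simpl; destruct eqdec; [|congruence].
      pose proof (drop_key_length key (key y) l); lia.
    * intros e' y' I; apply (Ad e'), (drop_key_incl _ _ _ _ I).
    * intros e1 y1 e2 y2 I1 I2; apply (Ed e1 y1 e2 y2); eapply drop_key_incl; eauto.
    * intros a; destruct (eqdec (key y) a) as [<-|N].
      -- apply coef_drop_same.
      -- rewrite coef_drop_other; auto.
  + apply (Ad e); left; auto.
  + intros e' y' I; split; [apply (Ad e'); auto|].
    intros; apply (Ed e' y' e y); auto; left; auto.
Qed.

End Abelian.
End WeightedLists.

(** * Normal forms modulo a subgroup with abelian quotient *)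

Definition vec := nat -> Z.
Definition vzero : vec := fun _ => 0%Z.
Definition vadd (a b : vec) : vec := fun i => (a i + b i)%Z.
Definition vopp (a : vec) : vec := fun i => (- a i)%Z.
Definition vdelta (n : nat) : vec := fun i => if i =? n then 1%Z else 0%Z.

Ltac vec_eq := let i := fresh "i" in extensionality i; unfold vadd, vopp, vzero; lia.

(* Exponent sums; variables of index at least [r] count as trivial, as in [basis_assign]. *)
Fixpoint exw (r : nat) (w : term Empty_set) : vec :=
  match w with
  | TVar n => if n <? r then vdelta n else vzero
  | TCst _ | TOne => vzero
  | TMul w1 w2 => vadd (exw r w1) (exw r w2)
  | TInv w1 => vopp (exw r w1)
  end.

Fixpoint prodpow {G : group} (y : nat -> G) (n : nat) (e : vec) : G :=
  match n with 0 => gone | S m => prodpow y m e ** zpow (y m) (e m) end.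

Section NormalForm.
Context {G : group} (y : nat -> G).

Lemma prodpow0 n (e : vec) : (forall i, i < n -> e i = 0%Z) -> prodpow y n e = gone.
Proof.
induction n; simpl; auto; intros e0.
rewrite IHn, e0, zpow0; auto; grp.
Qed.

Lemma prodpow_delta n i : i < n -> prodpow y n (vdelta i) = y i.
Proof.
induction n; simpl; intros; [lia|]; unfold vdelta at 2; destruct (Nat.eqb_spec n i).
- subst; rewrite prodpow0, zpow1; [grp|].
  intros j lj; unfold vdelta; destruct (Nat.eqb_spec j i); lia.
- rewrite IHn, zpow0 by lia; grp.
Qed.

Context (K N : G -> Prop) (sK : subgroup K) (sN : subgroup N).
Hypothesis nN : forall h a, K h -> N a -> N (conjg h a).
Hypothesis KN : forall a b, K a -> K b -> N (comm a b).

(** Congruence modulo N inside K, where K/N is abelian. It serves for G modulo G' and for H modulo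
    H'. *)
Definition cong (a b : G) : Prop := N (a ** b^-1).

Lemma cong_refl a : cong a a.
Proof. unfold cong; rewrite mulgV; apply (sub1 N sN). Qed.

Lemma cong_trans a b c : cong a b -> cong b c -> cong a c.
Proof.
unfold cong; intros ab bc; replace (a ** c^-1) with (a ** b^-1 ** (b ** c^-1)) by grp.
apply subM; auto.
Qed.

Lemma cong_sym a b : cong a b -> cong b a.
Proof.
unfold cong; intros ab; replace (b ** a^-1) with ((a ** b^-1)^-1) by grp; apply subV; auto.
Qed.

Lemma cong_mul a a' b b' : K a -> cong a a' -> cong b b' -> cong (a ** b) (a' ** b').
Proof.
unfold cong; intros Ka aa' bb'.
replace (a ** b ** (a' ** b')^-1) with (conjg a (b ** b'^-1) ** (a ** a'^-1))
  by (unfold conjg; grp).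
apply subM; auto.
Qed.

Lemma cong_inv a b : K a -> cong a b -> cong (a^-1) (b^-1).
Proof.
intros Ka ab; apply cong_sym in ab; unfold cong in *.
replace (a^-1 ** b^-1^-1) with (conjg (a^-1) (b ** a^-1)) by (unfold conjg; grp).
apply nN; auto; apply subV; auto.
Qed.

Lemma cong_comm a b : K a -> K b -> cong (a ** b) (b ** a).
Proof.
intros Ka Kb; unfold cong.
replace (a ** b ** (b ** a)^-1) with (comm (a^-1) (b^-1)) by grp.
apply KN; apply subV; auto.
Qed.

Hypothesis Ky : forall n, K (y n).

Lemma prodpow_sub n e : K (prodpow y n e).
Proof.
induction n; simpl; [apply (sub1 K sK)|]; apply subM; auto; apply zpow_sub; auto.
Qed.

Lemma prodpow_add n e e' : cong (prodpow y n (vadd e e')) (prodpow y n e ** prodpow y n e').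
Proof.
induction n; simpl; [rewrite mulg1; apply cong_refl|].
set (P := prodpow y n) in *; set (u := zpow (y n)) in *.
assert (KP : forall e, K (P e)) by (intros; apply prodpow_sub).
assert (Ku : forall m, K (u m)) by (intros; apply zpow_sub; auto).
apply cong_trans with (P e ** P e' ** (u (e n) ** u (e' n))).
- unfold vadd at 2, u; rewrite zpowD; apply cong_mul; auto using cong_refl; apply KP.
- replace (P e ** P e' ** (u (e n) ** u (e' n)))
    with (P e ** (P e' ** u (e n) ** u (e' n))) by grp.
  replace (P e ** u (e n) ** (P e' ** u (e' n)))
    with (P e ** (u (e n) ** P e' ** u (e' n))) by grp.
  apply cong_mul; auto using cong_refl.
  apply cong_mul; auto using cong_refl, cong_comm; apply subM; auto.
Qed.

Lemma prodpow_opp n e : cong (prodpow y n (vopp e)) ((prodpow y n e)^-1).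
Proof.
assert (H := prodpow_add n (vopp e) e).
rewrite (prodpow0 n (vadd _ _)) in H by (intros; unfold vadd, vopp; lia).
apply cong_sym in H; unfold cong in *; rewrite invg1, mulg1 in H; rewrite invgK; exact H.
Qed.

(** In the abelian quotient K/N the factors of a word can be sorted, so only its exponent sums
    remain. *)
Lemma weval_cong r w : cong (weval (basis_assign r y) w) (prodpow y r (exw r w)).
Proof.
assert (Kb : forall n, K (basis_assign r y n)).
{ intros n; unfold basis_assign; destruct (n <? r); auto; apply (sub1 K sK). }
assert (Kw : forall w, K (weval (basis_assign r y) w)) by (intros; apply weval_sub; auto).
induction w as [n|[]| |w1 IH1 w2 IH2|w IH]; simpl.
- unfold weval, basis_assign; simpl; destruct (Nat.ltb_spec n r).
  + rewrite prodpow_delta by auto; apply cong_refl.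
  + rewrite prodpow0 by auto; apply cong_refl.
- rewrite prodpow0 by auto; apply cong_refl.
- apply cong_trans with (prodpow y r (exw r w1) ** prodpow y r (exw r w2)).
  + apply cong_mul; auto; apply Kw.
  + apply cong_sym, prodpow_add.
- apply cong_trans with ((prodpow y r (exw r w))^-1).
  + apply cong_inv; auto; apply Kw.
  + apply cong_sym, prodpow_opp.
Qed.

Lemma weval_ex0 r w : (forall i, i < r -> exw r w i = 0%Z) -> N (weval (basis_assign r y) w).
Proof.
intros e0; assert (H := weval_cong r w); rewrite prodpow0 in H by auto.
unfold cong in H; rewrite invg1, mulg1 in H; exact H.
Qed.

End NormalForm.

(** * Concrete target groups *)

Definition Zgrp : group := Group Z Z.add 0%Z Z.opp Z.add_assoc Z.add_0_l Z.add_opp_diag_l.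

Lemma zpow_Z (z : Zgrp) n : zpow z n = (n * z)%Z.
Proof.
induction n as [|n IH|n IH] using Z.peano_ind.
- reflexivity.
- rewrite <- Z.add_1_r, zpow_succ, IH; simpl; lia.
- rewrite <- Z.sub_1_r, zpow_pred, IH; simpl; lia.
Qed.

Definition vgrp : group.
Proof. refine (Group vec vadd vzero vopp _ _ _); intros; vec_eq. Defined.

Lemma zpow_vgrp (a : vgrp) n i : (zpow a n : vec) i = (n * a i)%Z.
Proof.
rewrite <- (zpow_Z (a i : Zgrp)).
apply (hom_zpow (fun a : vgrp => (a i : Zgrp))); intros u v; reflexivity.
Qed.

(** The triple (a, b, c) is the unitriangular 3x3 integer matrix with a and b above the diagonal and
    c in the corner. *)
Definition heis : group.
Proof.
refine (Group (Z * Z * Z)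
  (fun p q => let '(a, b, c) := p in let '(a', b', c') := q in
              (a + a', b + b', c + c' + a * b')%Z)
  (0, 0, 0)%Z (fun p => let '(a, b, c) := p in (- a, - b, a * b - c)%Z) _ _ _);
  repeat intros [[? ?] ?]; (apply f_equal2; [apply f_equal2|]; ring).
Defined.

Lemma comm_heis (p q : heis) :
  comm p q = (0, 0, fst (fst p) * snd (fst q) - fst (fst q) * snd (fst p))%Z.
Proof.
destruct p as [[? ?] ?], q as [[? ?] ?]; unfold comm; simpl.
apply f_equal2; [apply f_equal2|]; ring.
Qed.

Lemma heis_class2 : metabelian heis /\ nilpotent_le 2 heis.
Proof.
split; [intros a b c d|intros s; change (comm (comm (s 0) (s 1)) (s 2) = gone)];
  rewrite !comm_heis; simpl; f_equal; ring.
Qed.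

Lemma vgrp_class2 : metabelian vgrp /\ nilpotent_le 2 vgrp.
Proof.
split; [intros a b c d|intros s; simpl]; unfold comm; simpl; vec_eq.
Qed.

(* The unrestricted wreath product of [Z^r] with [Z^r]: an element is a 1-chain on the
   Cayley graph of [Z^r] (an edge is a direction and its origin) with an endpoint. *)
Definition magnus : group.
Proof.
refine (Group ((nat -> vec -> Z) * vec)
  (fun p q => (fun i b => (fst p i b + fst q i (vadd b (vopp (snd p))))%Z, vadd (snd p) (snd q)))
  (fun _ _ => 0%Z, vzero)
  (fun p => (fun i b => (- fst p i (vadd b (snd p)))%Z, vopp (snd p))) _ _ _).
- intros [F a] [F' a'] [F'' a'']; simpl; apply f_equal2; [|vec_eq].
  extensionality i; extensionality b; rewrite Z.add_assoc; do 2 f_equal; vec_eq.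
- intros [F a]; simpl; apply f_equal2; [|vec_eq].
  extensionality i; extensionality b; simpl; f_equal; vec_eq.
- intros [F a]; simpl; apply f_equal2; [|vec_eq].
  extensionality i; extensionality b.
  replace (vadd b (vopp (vopp a))) with (vadd b a) by vec_eq; lia.
Defined.

Lemma fst_magnus_mul (p q : magnus) i b :
  fst (p ** q) i b = (fst p i b + fst q i (vadd b (vopp (snd p))))%Z.
Proof. reflexivity. Qed.

Lemma snd_magnus_mul (p q : magnus) : snd (p ** q) = vadd (snd p) (snd q).
Proof. reflexivity. Qed.

(** Commutators end at the origin, and elements ending at the origin multiply by adding their
    chains. *)
Lemma magnus_metabelian : metabelian magnus.
Proof.
assert (C : forall p q : magnus, snd (comm p q) = vzero).
{ intros [F a] [F' a']; unfold comm; simpl; vec_eq. }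
intros p q s t; apply commute_comm.
generalize (C p q), (C s t); generalize (comm p q), (comm s t).
intros [F a] [F' a']; simpl; intros -> ->; f_equal.
extensionality i; extensionality b.
replace (vadd b (vopp vzero)) with b by vec_eq; lia.
Qed.

(** * Torsion-freeness of modules over the group ring of [Z^r] *)

(** Lexicographic order on the first n coordinates, the last of them being the most significant. It
    makes Z^r an ordered group, which is why its group ring has no zero divisors. *)
Fixpoint lexlt (n : nat) (a b : vec) : Prop :=
  match n with 0 => False | S m => (a m < b m \/ a m = b m /\ lexlt m a b)%Z end.

Definition supp (r : nat) (a : vec) : Prop := forall i, r <= i -> a i = 0%Z.

Lemma lexlt_total n a b :
  lexlt n a b \/ lexlt n b a \/ (forall i, i < n -> a i = b i).
Proof.
induction n; simpl; [right; right; lia|].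
destruct (Z.lt_trichotomy (a n) (b n)) as [|[E|]]; auto.
destruct IHn as [|[|H]]; auto.
right; right; intros i li; destruct (Nat.eq_dec i n) as [->|]; auto; apply H; lia.
Qed.

Lemma lexlt_trans n a b c : lexlt n a b -> lexlt n b c -> lexlt n a c.
Proof.
induction n; simpl; auto; intros [|[]] [|[]]; try (left; lia); right; split; auto; lia.
Qed.

Lemma lexlt_irrefl n a : ~ lexlt n a a.
Proof. induction n; simpl; auto; intros [|[]]; auto; lia. Qed.

(** Translation invariance, in the form where a smaller key shifts the evaluation point beyond c. *)
Lemma lexlt_shift n a b c : lexlt n a b -> lexlt n c (vadd (vadd b c) (vopp a)).
Proof.
induction n; simpl; auto; unfold vadd at 1 3, vopp at 1 3.
intros [|[]]; [left; unfold vadd, vopp; lia|right; split; [unfold vadd, vopp; lia|auto]].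
Qed.

Lemma lex_max r (l : list vec) :
  l <> [] -> (forall a, In a l -> supp r a) ->
  exists m, In m l /\ forall a, In a l -> a = m \/ lexlt r a m.
Proof.
induction l as [|a l IH]; [congruence|]; intros _ sl.
destruct l as [|b l]; [exists a; split; [left; auto|intros ? [->|[]]; auto]|].
destruct IH as (m & Im & Hm); [congruence|intros; apply sl; right; auto|].
destruct (lexlt_total r a m) as [L|[L|E]].
- exists m; split; [right; auto|]; intros c [<-|Ic]; auto.
- exists a; split; [left; auto|]; intros c [<-|Ic]; auto.
  right; destruct (Hm c Ic) as [->|Lc]; auto; eapply lexlt_trans; eauto.
- exists m; split; [right; auto|]; intros c [<-|Ic]; auto; left.
  extensionality i; destruct (le_lt_dec r i); auto.
  rewrite (sl a), (sl m); auto; [right|left]; auto.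
Qed.

Section Convolution.
Context {X : Type} (r : nat) (key : X -> vec) (v : vec -> Z) (supv : list vec) (b0 : vec).
Hypothesis v_supp : forall b, v b <> 0%Z -> In b supv.
Hypothesis supv_supp : forall b, In b supv -> supp r b.
Hypothesis v_b0 : v b0 <> 0%Z.

(** The value at b of the product of two elements of the group ring of Z^r: the image of l under
    [key], and v. *)
Definition conv (l : list (Z * X)) (b : vec) : Z :=
  lprod (fun y => v (vadd b (vopp (key y))) : Zgrp) l.

Lemma conv_split l y0 b :
  conv l b = (coef key l (key y0) * v (vadd b (vopp (key y0))) +
              conv (drop_key key (key y0) l) b)%Z.
Proof.
unfold conv; rewrite (lprod_split (G := Zgrp) (fun _ => True)) with (key := key) (y0 := y0).
- rewrite zpow_Z; reflexivity.
- split; auto.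
- intros; apply Z.add_comm.
- exact I.
- intros e y _; split; auto; intros ->; auto.
Qed.

(* The lexicographically largest key of [l] plus the largest point of the support of [v]
   is reached only once in the convolution. *)
Lemma conv_eq0 l :
  (forall e y, In (e, y) l -> supp r (key y)) -> (forall b, conv l b = 0%Z) ->
  forall a, coef key l a = 0%Z.
Proof.
(* [supv] may be larger than the support of v, so its zeros are removed before the maximum is
   taken. *)
destruct (lex_max r (filter (fun b => if Z.eq_dec (v b) 0 then false else true) supv))
  as (bm & Ibm & Hbm).
{ intros E; assert (I0 : In b0 []) by
    (rewrite <- E; apply filter_In; split; auto; destruct Z.eq_dec; auto).
  destruct I0. }
{ intros a Ia; apply filter_In in Ia; apply supv_supp; tauto. }
assert (vbm : v bm <> 0%Z).
{ apply filter_In in Ibm; destruct (Z.eq_dec (v bm) 0); auto; destruct Ibm; congruence. }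
assert (v0 : forall b, lexlt r bm b -> v b = 0%Z).
{ intros b L; destruct (Z.eq_dec (v b) 0) as [|n0]; auto; exfalso.
  destruct (Hbm b) as [->|L'].
  - apply filter_In; split; auto; destruct Z.eq_dec; auto.
  - exact (lexlt_irrefl _ _ L).
  - exact (lexlt_irrefl _ _ (lexlt_trans _ _ _ _ L L')). }
clear Ibm Hbm.
remember (length l) as n eqn:En; assert (Hn : length l <= n) by lia; clear En.
revert l Hn; induction n; intros l Hn sl c0 a.
- destruct l; simpl in *; [auto|lia].
- destruct l as [|[e1 y1] l1] eqn:El; auto; rewrite <- El in *.
  destruct (lex_max r (map (fun p => key (snd p)) l)) as (m & Im & Hm).
  + rewrite El; discriminate.
  + intros b Ib; apply in_map_iff in Ib; destruct Ib as ([e y] & <- & Iy); eapply sl; eauto.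
  + apply in_map_iff in Im; destruct Im as ([e y] & <- & Iy); simpl in Hm.
    assert (cy : coef key l (key y) = 0%Z).
    (* At the sum of the two maxima every entry with a smaller key meets v beyond [bm], where v
       vanishes; only the coefficient times [v bm] survives. *)
    { specialize (c0 (vadd (key y) bm)); rewrite (conv_split l y) in c0.
      replace (conv (drop_key key (key y) l) (vadd (key y) bm)) with 0%Z in c0.
      - replace (vadd (vadd (key y) bm) (vopp (key y))) with bm in c0 by vec_eq.
        apply Z.mul_eq_0_l with (v bm); auto; lia.
      - symmetry; apply (lprod_sub (G := Zgrp) (fun z => z = 0%Z)).
        + split; auto; intros; subst; auto.
        + intros e' y' I'; apply v0, lexlt_shift.
          destruct (Hm (key y')) as [E|]; auto.
          * apply in_map_iff; exists (e', y'); split; auto; eapply drop_key_incl; eauto.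
          * destruct (drop_key_neq _ _ _ _ _ I' E). }
    destruct (eqdec (key y) a) as [<-|ne]; auto.
    rewrite <- (coef_drop_other key (key y)) by auto.
    apply IHn.
    * assert (length (drop_key key (key y) l) < length l); [|lia].
      clear -Iy; induction l as [|[e' y'] l IH]; simpl; [destruct Iy|].
      pose proof (drop_key_length key (key y) l).
      destruct eqdec; simpl; [lia|]; destruct Iy as [E|Iy]; [congruence|].
      specialize (IH Iy); lia.
    * intros e' y' I'; apply (sl e'); eapply drop_key_incl; eauto.
    * intros b; specialize (c0 b); rewrite (conv_split l y), cy in c0; lia.
Qed.

End Convolution.

(** The augmentation is the value in Z of the list with every element sent to 1, so [lprod_coef0]
    applies. *)
Lemma wsum_coef0 {X Y : Type} (key : X -> Y) (l : list (Z * X)) :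
  (forall a, coef key l a = 0%Z) -> wsum l = 0%Z.
Proof.
intros c0.
transitivity (lprod (fun _ : X => (1%Z : Zgrp)) l).
- clear c0; induction l as [|[e y] l IH]; simpl; auto; rewrite IH, zpow_Z; lia.
- apply (lprod_coef0 (G := Zgrp) (fun _ => True)) with (key := key); auto.
  + split; auto.
  + intros; apply Z.add_comm.
Qed.

(** * Relatively free metabelian groups *)

Lemma full_subgroup (G : group) : subgroup (fun _ : G => True).
Proof. split; auto. Qed.

Notation der G := (mutual_comm (fun _ : carrier G => True) (fun _ : carrier G => True)).

Lemma der_normal (G : group) (h a : G) : der G a -> der G (conjg h a).
Proof. intros; apply mutual_comm_normal; auto using full_subgroup. Qed.

(** Centralizers are subgroups, so it suffices to let the generating commutators commute, one
    argument at a time. *)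
Lemma der_abelian (G : group) : metabelian G ->
  forall a b : G, der G a -> der G b -> a ** b = b ** a.
Proof.
intros mG.
assert (C : forall z : G, subgroup (fun a => a ** z = z ** a)).
{ intros z; split; [grp| |].
  - intros a b Ea Eb; rewrite mulgA_r, Eb, gmulA, Ea; grp.
  - intros a E; symmetry; apply commute_inv; symmetry; exact E. }
intros a b Da Db; revert a Da; apply gen_min; [apply C|].
intros _ (a1 & a2 & _ & _ & ->); symmetry; revert b Db; apply gen_min; [apply C|].
intros _ (b1 & b2 & _ & _ & ->); apply comm_eq1, mG.
Qed.

Lemma lcs_der (G : group) (K : G -> Prop) j a : lcs K (S j) a -> der G a.
Proof.
apply gen_min; [apply gen_subgroup|].
intros _ (b & c & _ & _ & ->); apply mutual_comm_in; auto.
Qed.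

(** The retraction is phi followed by the inverse of its restriction to K. The preimages are picked
    by choice, and injectivity on K makes the result a homomorphism. *)
Lemma retract_of_bij (G : group) (K : G -> Prop) (phi : G -> G) :
  subgroup K -> is_hom phi -> (forall y, K (phi y)) ->
  (forall y, K y -> exists h, K h /\ phi h = y) ->
  (forall h, K h -> phi h = gone -> h = gone) -> retract K.
Proof.
intros sK phiM phiK surj inj.
assert (inj2 : forall a b, K a -> K b -> phi a = phi b -> a = b).
{ intros a b Ka Kb E; apply mulg_eq1, inj; [apply subM; auto; apply subV; auto|].
  rewrite phiM, homV, E; auto; apply mulgV. }
set (rho := fun y => proj1_sig (constructive_indefinite_description _ (surj (phi y) (phiK y)))).
assert (rhoP : forall y, K (rho y) /\ phi (rho y) = phi y).
{ intros y; exact (proj2_sig (constructive_indefinite_description _ (surj (phi y) (phiK y)))). }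
exists rho; split; [|split].
- intros a b; destruct (rhoP a), (rhoP b), (rhoP (a ** b)); apply inj2; auto.
  + apply subM; auto.
  + rewrite phiM; congruence.
- intros a; apply rhoP.
- intros h Kh; destruct (rhoP h); apply inj2; auto.
Qed.

(** [basis_assign] sends the variables from index r on to 1, whereas verbal closedness lets every
    variable vary; erasing those variables reconciles the two. *)
Fixpoint trunc (r : nat) (w : term Empty_set) : term Empty_set :=
  match w with
  | TVar n => if n <? r then TVar n else TOne
  | TCst e => TCst e
  | TOne => TOne
  | TMul w1 w2 => TMul (trunc r w1) (trunc r w2)
  | TInv w1 => TInv (trunc r w1)
  end.

Lemma weval_trunc {G : group} r (a : nat -> G) w :
  weval a (trunc r w) = weval (basis_assign r a) w.
Proof.
induction w as [n|[]| |w1 IH1 w2 IH2|w IH]; unfold weval in *; simpl; try congruence.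
unfold basis_assign; destruct (n <? r); reflexivity.
Qed.

Section Gen2.
Context {G : group} (g f : G).
Notation H := (gen2 g f).

Lemma gen2_subgroup : subgroup H.
Proof.
split.
- exists TOne; reflexivity.
- intros _ _ [w1 <-] [w2 <-]; exists (TMul w1 w2); reflexivity.
- intros _ [w <-]; exists (TInv w); reflexivity.
Qed.

Lemma gen2_l : H g.
Proof. exists (TVar 0); reflexivity. Qed.

Lemma gen2_r : H f.
Proof. exists (TVar 1); reflexivity. Qed.

Lemma gen2_min (K : G -> Prop) : subgroup K -> K g -> K f -> forall h, H h -> K h.
Proof.
intros sK Kg Kf _ [w <-]; apply weval_sub; auto.
intros [|[|n]]; auto; apply (sub1 K sK).
Qed.

End Gen2.

Section RelFree.
Context (V : group -> Prop) (r : nat) (G : group) (x : nat -> G).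
Hypothesis free : rel_free V r G x.
Notation bas := (basis_assign r x).

Lemma word_of (y : G) : exists w, weval bas w = y.
Proof. apply free. Qed.

Lemma hom_word {M : group} (phi : G -> M) w : is_hom phi ->
  phi (weval bas w) = weval (basis_assign r (fun i => phi (x i))) w.
Proof.
intros phiM; rewrite hom_weval by auto; apply weval_ext; intros n.
unfold basis_assign; destruct (n <? r); auto; apply hom1; auto.
Qed.

Lemma weval_assign_ext {M : group} (a b : nat -> M) w :
  (forall i, i < r -> a i = b i) -> weval (basis_assign r a) w = weval (basis_assign r b) w.
Proof.
intros E; apply weval_ext; intros n; unfold basis_assign.
destruct (Nat.ltb_spec n r); auto.
Qed.

Lemma hom_ext {M : group} (phi psi : G -> M) : is_hom phi -> is_hom psi ->
  (forall i, i < r -> phi (x i) = psi (x i)) -> forall y, phi y = psi y.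
Proof.
intros phiM psiM E y; destruct (word_of y) as [w <-].
rewrite !hom_word by auto; apply weval_assign_ext; auto.
Qed.

Lemma hom_into (K : G -> Prop) (a : nat -> G) : subgroup K -> (forall i, i < r -> K (a i)) ->
  exists phi : G -> G, is_hom phi /\ (forall i, i < r -> phi (x i) = a i) /\ forall y, K (phi y).
Proof.
intros sK Ka; destruct free as (VG & _ & ext).
destruct (ext G VG a) as (phi & phiM & phix).
exists phi; repeat split; auto.
intros y; destruct (word_of y) as [w <-]; rewrite hom_word by auto.
apply weval_sub; auto; intros n; unfold basis_assign.
destruct (Nat.ltb_spec n r); [rewrite phix; auto|apply (sub1 K sK)].
Qed.

(** Write h as a word in the basis. The basis solves the equation word = h in G, so some tuple of H
    solves it too; freeness lets the basis be mapped to that tuple. *)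
Lemma verb_closed_hom (g f : G) : verb_closed (gen2 g f) -> forall h, gen2 g f h ->
  exists phi : G -> G, is_hom phi /\ (forall y, gen2 g f (phi y)) /\ phi h = h.
Proof.
intros vc h Hh; destruct (word_of h) as [w Ew].
destruct (vc (trunc r w) h Hh) as [[a [Ha Ea]] _].
{ exists x; rewrite weval_trunc; exact Ew. }
destruct (hom_into (gen2 g f) a) as (phi & phiM & phix & phiH); auto using gen2_subgroup.
exists phi; repeat split; auto.
rewrite weval_trunc in Ea; rewrite <- Ew at 1; rewrite hom_word, <- Ea by auto.
apply weval_assign_ext; auto.
Qed.

Context (ab : G -> vgrp) (abM : is_hom ab).
Hypothesis ab_x : forall i, i < r -> ab (x i) = vdelta i.

Lemma ab_word w : ab (weval bas w) = exw r w.
Proof.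
induction w as [n|[]| |w1 IH1 w2 IH2|w IH]; unfold weval in *; simpl.
- unfold basis_assign; destruct (Nat.ltb_spec n r); auto; apply (hom1 ab); auto.
- apply (hom1 ab); auto.
- rewrite abM, IH1, IH2; reflexivity.
- rewrite (homV ab), IH; auto.
Qed.

Lemma exw_supp w : supp r (exw r w).
Proof.
induction w as [n|[]| |w1 IH1 w2 IH2|w IH]; simpl; intros i ri; auto.
- destruct (Nat.ltb_spec n r); auto; unfold vdelta; destruct (Nat.eqb_spec i n); auto; lia.
- unfold vadd; rewrite IH1, IH2; auto.
- unfold vopp; rewrite IH; auto.
Qed.

Lemma ab_supp y : supp r (ab y).
Proof. destruct (word_of y) as [w <-]; rewrite ab_word; apply exw_supp. Qed.

Lemma ab_mul a b i : ab (a ** b) i = (ab a i + ab b i)%Z.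
Proof. rewrite abM; reflexivity. Qed.

Lemma ab_inv a i : ab (a^-1) i = (- ab a i)%Z.
Proof. rewrite (homV ab); auto. Qed.

Lemma ab_one i : ab gone i = 0%Z.
Proof. rewrite (hom1 ab); auto. Qed.

Lemma ab_zpow a n i : ab (zpow a n) i = (n * ab a i)%Z.
Proof. rewrite (hom_zpow ab) by auto; apply zpow_vgrp. Qed.

Lemma ab_eq0_der y : (forall i, ab y i = 0%Z) -> der G y.
Proof.
destruct (word_of y) as [w <-]; rewrite ab_word; intros e0.
apply (weval_ex0 x (fun _ => True)); auto using full_subgroup.
- apply gen_subgroup.
- intros; apply der_normal; auto.
- intros; apply mutual_comm_in; auto.
Qed.

Lemma der_ab_eq0 y : der G y -> ab y = vzero.
Proof.
apply (gen_min _ (fun y => ab y = vzero)).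
- split; [apply (hom1 ab); auto|intros a b Ea Eb; rewrite abM, Ea, Eb|intros a Ea; rewrite (homV ab), Ea];
    auto; reflexivity.
- intros _ (a & b & _ & _ & ->); rewrite (hom_comm ab) by auto; unfold comm; simpl; vec_eq.
Qed.

(** ** The Magnus embedding *)

(** The signed edges of the path that w traces in the Cayley graph of Z^r from a. For an inverse,
    the path of w that ends at a is run backwards. *)
Fixpoint edges (w : term Empty_set) (a : vec) : list (Z * (nat * vec)) :=
  match w with
  | TVar n => if n <? r then [(1%Z, (n, a))] else []
  | TCst _ | TOne => []
  | TMul w1 w2 => edges w1 a ++ edges w2 (vadd a (exw r w1))
  | TInv w1 => nlist (edges w1 (vadd a (vopp (exw r w1))))
  end.

Lemma edges_range w a e i b : In (e, (i, b)) (edges w a) -> i < r /\ (supp r a -> supp r b).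
Proof.
revert a e; induction w as [n|[]| |w1 IH1 w2 IH2|w IH]; simpl; intros a e; try tauto.
- destruct (Nat.ltb_spec n r); simpl; [|tauto].
  intros [E|[]]; inversion E; subst; auto.
- intros [I|I]%in_app_iff; [eauto|]; apply IH2 in I; destruct I as [li I]; split; auto.
  intros sa; apply I; intros j rj; unfold vadd; rewrite sa, exw_supp; auto.
- intros I; apply in_map_iff in I; destruct I as ([e' [i' b']] & E & I); simpl in E.
  inversion E; subst; apply IH in I; destruct I as [li I]; split; auto.
  intros sa; apply I; intros j rj; unfold vadd, vopp; rewrite sa, exw_supp; auto.
Qed.

Definition magnus_gen (n : nat) : magnus :=
  (fun j b => if eqdec (n, vzero) (j, b) then 1%Z else 0%Z, vdelta n).

(** The Magnus image of a word is the chain and endpoint of its path; starting at a instead of the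
    origin translates the chain by a. *)
Lemma magnus_edges w :
  snd (weval (basis_assign r magnus_gen) w) = exw r w /\
  forall a i b, coef id (edges w a) (i, b) =
    fst (weval (basis_assign r magnus_gen) w) i (vadd b (vopp a)).
Proof.
induction w as [n|[]| |w1 [E1 F1] w2 [E2 F2]|w [E F]]; set (A := basis_assign r magnus_gen) in *.
- unfold A, weval, basis_assign; simpl; destruct (Nat.ltb_spec n r); simpl; split; auto.
  intros a i b; unfold id; rewrite Z.add_0_r.
  destruct eqdec as [Q|Q], eqdec as [R|R]; auto; exfalso.
  + inversion Q; subst; apply R; f_equal; vec_eq.
  + inversion R as [[Rn Rv]]; apply Q; f_equal; [exact Rn|]; extensionality j.
    apply (f_equal (fun v => v j)) in Rv; unfold vadd, vopp, vzero in Rv; lia.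
- split; auto.
- change (weval A (TMul w1 w2)) with (weval A w1 ** weval A w2); simpl.
  rewrite E1, E2; split; auto; intros a i b.
  rewrite coef_app, F1, F2; do 2 f_equal; vec_eq.
- change (weval A (TInv w)) with ((weval A w)^-1); simpl.
  rewrite E; split; auto; intros a i b.
  rewrite coef_nlist, F; do 2 f_equal; vec_eq.
Qed.

Hypothesis mG : metabelian G.

(** The Schreier generator of G' attached to an edge, for the transversal of ordered products
    [prodpow x r b]. *)
Definition schreier (p : nat * vec) : G :=
  prodpow x r (snd p) ** x (fst p) ** (prodpow x r (vadd (snd p) (vdelta (fst p))))^-1.

Lemma schreier_der i b : i < r -> der G (schreier (i, b)).
Proof.
intros li; unfold schreier; simpl.
assert (C := prodpow_add x (fun _ => True) (der G) (full_subgroup G) (gen_subgroup _)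
  (fun h a _ => der_normal G h a) (fun a b _ _ => mutual_comm_in _ _ a b I I) (fun _ => I)
  r b (vdelta i)).
rewrite (prodpow_delta x r i li) in C.
apply (cong_sym (der G)) in C; [exact C|apply gen_subgroup].
Qed.

(** Reidemeister-Schreier rewriting: in a product the two transversal elements at the intermediate
    vertex cancel. For an inverse the factors come in reverse order, which is harmless as G' is
    abelian. *)
Lemma schreier_edges w a :
  prodpow x r a ** weval bas w ** (prodpow x r (vadd a (exw r w)))^-1 =
  lprod schreier (edges w a).
Proof.
revert a; induction w as [n|[]| |w1 IH1 w2 IH2|w IH]; intros a; unfold weval in *; simpl.
- unfold basis_assign; destruct (Nat.ltb_spec n r); simpl.
  + rewrite zpow1, mulg1; reflexivity.
  + replace (vadd a vzero) with a by vec_eq; grp.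
- replace (vadd a vzero) with a by vec_eq; grp.
- rewrite lprod_app, <- IH1, <- IH2.
  replace (vadd a (vadd (exw r w1) (exw r w2))) with (vadd (vadd a (exw r w1)) (exw r w2))
    by vec_eq; grp.
- rewrite (lprod_nlist (der G)), <- IH.
  + replace (vadd (vadd a (vopp (exw r w))) (exw r w)) with a by vec_eq; grp.
  + apply gen_subgroup.
  + apply der_abelian; auto.
  + intros e [i b] Ie; apply edges_range in Ie; apply schreier_der; tauto.
Qed.

Section Magnus.
Context (mu : G -> magnus) (muM : is_hom mu).
Hypothesis mu_x : forall i, i < r -> mu (x i) = magnus_gen i.

Lemma mu_word w : mu (weval bas w) = weval (basis_assign r magnus_gen) w.
Proof. rewrite hom_word by auto; apply weval_assign_ext; auto. Qed.

Lemma snd_mu y : snd (mu y) = ab y.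
Proof. destruct (word_of y) as [w <-]; rewrite mu_word, ab_word; apply magnus_edges. Qed.

Lemma mu_edges w i b : fst (mu (weval bas w)) i b = coef id (edges w vzero) (i, b).
Proof.
rewrite mu_word, (proj2 (magnus_edges w)); f_equal; vec_eq.
Qed.

(* Telescoping over the Schreier transversal writes an element of the derived group as a
   product over its 1-chain, so it only depends on the chain. *)
Lemma magnus_faithful c : ab c = vzero -> (forall i b, fst (mu c) i b = 0%Z) -> c = gone.
Proof.
destruct (word_of c) as [w <-]; rewrite ab_word; intros e0 F0.
assert (S := schreier_edges w vzero); rewrite e0, !prodpow0 in S by auto.
rewrite gmul1, invg1, mulg1 in S; rewrite S.
apply (lprod_coef0 (der G)) with (key := id).
- apply gen_subgroup.
- apply der_abelian; auto.
- intros e [i b] Ie; apply edges_range in Ie; apply schreier_der; tauto.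
- intros; f_equal; auto.
- intros [i b]; rewrite <- mu_edges; apply F0.
Qed.

Lemma zpow_magnus (p : magnus) n : snd p = vzero ->
  snd (zpow p n) = vzero /\ forall i b, fst (zpow p n) i b = (n * fst p i b)%Z.
Proof.
intros p0; induction n as [|n [IH1 IH2]|n [IH1 IH2]] using Z.peano_ind.
- split; auto.
- rewrite <- Z.add_1_r, zpow_succ; simpl; rewrite IH1, p0; split; [vec_eq|intros i b].
  rewrite IH2; replace (vadd b (vopp vzero)) with b by vec_eq; lia.
- rewrite <- Z.sub_1_r, zpow_pred; simpl; rewrite IH1, p0; split; [vec_eq|intros i b].
  rewrite IH2; replace (vadd (vadd b (vopp vzero)) vzero) with b by vec_eq; lia.
Qed.

Lemma conj_magnus (p q : magnus) : snd p = vzero ->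
  snd (conjg q p) = vzero /\
  forall i b, fst (conjg q p) i b = fst p i (vadd b (vopp (snd q))).
Proof.
intros p0; unfold conjg; simpl; rewrite p0; split; [vec_eq|intros i b].
replace (vadd (vadd b (vopp (vadd (snd q) vzero))) (snd q)) with b by vec_eq; lia.
Qed.

(** Conjugation translates chains, so in each direction the relation says that the image of l in
    Z[Z^r] convolves the chain of c to zero. By faithfulness some direction i carries a nonzero
    chain v, and [conv_eq0] applies. *)
Lemma der_torsion_free {X : Type} (k : X -> G) (c : G) (l : list (Z * X)) :
  ab c = vzero -> c <> gone -> lprod (fun y => conjg (k y) c) l = gone ->
  forall a, coef (fun y => ab (k y) : vec) l a = 0%Z.
Proof.
intros c0 c1 lp.
destruct (classic (forall i b, fst (mu c) i b = 0%Z)) as [F0|F0].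
{ destruct (c1 (magnus_faithful c c0 F0)). }
apply not_all_ex_not in F0; destruct F0 as [i F0].
apply not_all_ex_not in F0; destruct F0 as [b0 F0].
set (v := fst (mu c) i) in *.
assert (vc : snd (mu c) = vzero) by (rewrite snd_mu; exact c0).
assert (C : forall l, snd (mu (lprod (fun y => conjg (k y) c) l)) = vzero /\
  forall b, fst (mu (lprod (fun y => conjg (k y) c) l)) i b =
            conv (fun y => ab (k y)) v l b).
{ clear l lp; induction l as [|[e y] l [IH1 IH2]]; simpl.
  - rewrite (hom1 mu) by auto; split; reflexivity.
  - destruct (conj_magnus (mu c) (mu (k y)) vc) as [Q1 Q2].
    destruct (zpow_magnus (conjg (mu (k y)) (mu c)) e Q1) as [R1 R2].
    split; [|intros b]; rewrite muM, (hom_zpow mu), (hom_conj mu) by auto.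
    { rewrite snd_magnus_mul, R1, IH1; vec_eq. }
    rewrite fst_magnus_mul, R1, R2, IH2, Q2, snd_mu; unfold conv; simpl; rewrite zpow_Z; fold v.
    replace (vadd b (vopp vzero)) with b by vec_eq; reflexivity. }
(* The support of v is finite: it lies among the origins of the edges of a word for c. *)
destruct (word_of c) as [w Ew].
apply (conv_eq0 r _ v (map (fun p => snd (snd p)) (edges w vzero)) b0); auto.
- intros b vb; unfold v in vb; rewrite <- Ew, mu_edges in vb.
  apply NNPP; intros nI; apply vb; revert nI; clear.
  induction (edges w vzero) as [|[e p] l IH]; simpl; auto; intros nI.
  rewrite IH by tauto; destruct eqdec as [E|]; auto.
  destruct nI; left; unfold id in E; subst; reflexivity.
- intros b Ib; apply in_map_iff in Ib; destruct Ib as ([e [j b']] & <- & Ie).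
  apply edges_range in Ie; apply Ie; intros ? ?; reflexivity.
- intros; apply ab_supp.
- intros b; destruct (C l) as [_ C2]; rewrite <- C2, lp, (hom1 mu) by auto; reflexivity.
Qed.

End Magnus.

(** * Verbally closed two-generated subgroups *)

Context (g f : G).
Notation H := (gen2 g f).
Notation N := (lcs H 1).
Hypothesis vc : verb_closed H.

Let sH : subgroup H := gen2_subgroup g f.

(** This gives that H meets G' exactly in H': a word for h has zero exponent sums, and phi turns it
    into a word with the same value h in elements of H. *)
Lemma vclosed_ab_eq0 h : H h -> (forall i, ab h i = 0%Z) -> N h.
Proof.
intros Hh h0; destruct (verb_closed_hom g f vc h Hh) as (phi & phiM & phiH & E).
destruct (word_of h) as [w Ew]; rewrite <- E, <- Ew, hom_word by auto.
apply (weval_ex0 (fun i => phi (x i)) H); auto.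
- apply gen_subgroup.
- apply (lcs_normal H 1); auto.
- intros; apply mutual_comm_in; auto.
- intros i _; rewrite <- ab_word, Ew; apply h0.
Qed.

Lemma gen2_ab h : H h -> exists p q, forall i, ab h i = (p * ab g i + q * ab f i)%Z.
Proof.
apply (gen2_min g f (fun h => exists p q, forall i, ab h i = (p * ab g i + q * ab f i)%Z)).
- split.
  + exists 0%Z, 0%Z; intros i; rewrite ab_one; lia.
  + intros a b (p & q & E) (p' & q' & E').
    exists (p + p')%Z, (q + q')%Z; intros i; rewrite ab_mul, E, E'; lia.
  + intros a (p & q & E); exists (- p)%Z, (- q)%Z; intros i; rewrite ab_inv, E; lia.
- exists 1%Z, 0%Z; intros; lia.
- exists 0%Z, 1%Z; intros; lia.
Qed.

(* [cspan n s]: [n] is the action on [[g,f]] of an element of [Z[H]] of augmentation [s]. *)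
Definition cspan (n : G) (s : Z) : Prop :=
  exists l : list (Z * G), (forall e y, In (e, y) l -> H y) /\ wsum l = s /\
    n = lprod (fun h => conjg h (comm g f)) l.

Lemma conj_comm_der h : der G (conjg h (comm g f)).
Proof. apply der_normal, mutual_comm_in; auto. Qed.

Lemma cspan_one : cspan gone 0.
Proof. exists []; repeat split; intros ? ? []. Qed.

Lemma cspan_mul a b s t : cspan a s -> cspan b t -> cspan (a ** b) (s + t).
Proof.
intros (l & Hl & El & ->) (l' & Hl' & El' & ->); exists (l ++ l'); repeat split.
- intros e y I; apply in_app_iff in I; destruct I; eauto.
- rewrite wsum_app; lia.
- rewrite lprod_app; auto.
Qed.

Lemma cspan_inv a s : cspan a s -> cspan (a^-1) (- s).
Proof.
intros (l & Hl & El & ->); exists (nlist l); repeat split.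
- intros e y I; apply in_map_iff in I; destruct I as ([e' y'] & E & I).
  simpl in E; inversion E; subst; eauto.
- rewrite wsum_nlist; lia.
- rewrite (lprod_nlist (der G)); auto.
  + apply gen_subgroup.
  + apply der_abelian; auto.
  + intros; apply conj_comm_der.
Qed.

Lemma cspan_conj h a s : H h -> cspan a s -> cspan (conjg h a) s.
Proof.
intros Hh (l & Hl & <- & ->).
exists (map (fun p => (fst p, h ** snd p)) l); repeat split.
- intros e y I; apply in_map_iff in I; destruct I as ([e' y'] & E & I).
  simpl in E; inversion E; subst; apply subM; eauto.
- clear; induction l as [|[e y] l IH]; simpl; auto; rewrite IH; auto.
- rewrite (hom_lprod (conjg h)) by (intros ? ?; apply conjMg).
  clear; induction l as [|[e y] l IH]; simpl; auto; rewrite IH, conjgM; auto.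
Qed.

Lemma cspan_comm : cspan (comm g f) 1.
Proof.
exists [(1%Z, gone)]; repeat split.
- intros e y [E|[]]; inversion E; subst; apply (sub1 H sH).
- simpl; rewrite zpow1; unfold conjg; grp.
Qed.

(** Invariance of Q absorbs the conjugations in the commutator identities. This reduces claims about
    commutators of H to the generators. *)
Lemma comm_sub_subgroup (Q : G -> Prop) b :
  subgroup Q -> (forall h a, H h -> Q a -> Q (conjg h a)) ->
  subgroup (fun a => H a /\ Q (comm a b)).
Proof.
intros sQ nQ; split.
- split; [apply (sub1 H sH)|]; replace (comm gone b) with (gone : G) by grp; apply (sub1 Q sQ).
- intros a a' [Ha Qa] [Ha' Qa']; split; [apply subM; auto|].
  rewrite commMg; apply subM; auto; apply nQ; auto; apply subV; auto.
- intros a [Ha Qa]; split; [apply subV; auto|].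
  replace (comm (a^-1) b) with (conjg a ((comm a b)^-1)) by (unfold conjg; grp).
  apply nQ; auto; apply subV; auto.
Qed.

Lemma der_gen2_cspan n : N n -> exists s, cspan n s.
Proof.
set (Q := fun n => exists s, cspan n s).
assert (sQ : subgroup Q).
{ split; [exists 0%Z; apply cspan_one|intros a b [s A] [t B]|intros a [s A]].
  - exists (s + t)%Z; apply cspan_mul; auto.
  - exists (- s)%Z; apply cspan_inv; auto. }
assert (nQ : forall h a, H h -> Q a -> Q (conjg h a)).
{ intros h a Hh [s A]; exists s; apply cspan_conj; auto. }
assert (Qc : Q (comm g f)) by (exists 1%Z; apply cspan_comm).
assert (Q1 : forall a, Q (comm a a)).
{ intros a; replace (comm a a) with (gone : G) by grp; apply (sub1 Q sQ). }
assert (QS : forall a b, Q (comm a b) -> Q (comm b a)).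
{ intros a b; rewrite <- (invg_comm a b); apply subV; auto. }
apply (gen_min _ Q); auto; intros _ (a & b & Ha & Hb & ->).
(* The first argument is reduced to g or f; swapping the arguments then reduces the other one in the
   same way. *)
apply (gen2_min g f (fun a => H a /\ Q (comm a b))); auto.
- apply comm_sub_subgroup; auto.
- split; [apply gen2_l|]; apply QS.
  apply (gen2_min g f (fun b => H b /\ Q (comm b g))); auto.
  + apply comm_sub_subgroup; auto.
  + split; [apply gen2_l|auto].
  + split; [apply gen2_r|auto].
- split; [apply gen2_r|]; apply QS.
  apply (gen2_min g f (fun b => H b /\ Q (comm b f))); auto.
  + apply comm_sub_subgroup; auto.
  + split; [apply gen2_l|auto].
  + split; [apply gen2_r|auto].
Qed.

(** Since [a,h] is the inverse of a times a conjugate of a, the augmentations of the two factors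
    cancel. *)
Lemma lcs2_cspan n : lcs H 2 n -> cspan n 0.
Proof.
apply (gen_min _ (fun n => cspan n 0)).
- split; [apply cspan_one|intros a b A B; apply (cspan_mul _ _ _ _ A B)|].
  intros a A; apply (cspan_inv _ _ A).
- intros _ (a & h & Na & Hh & ->); destruct (der_gen2_cspan a Na) as [s A].
  replace (comm a h) with (a^-1 ** conjg (h^-1) a) by (unfold conjg; grp).
  replace 0%Z with (- s + s)%Z by lia; apply cspan_mul; [apply cspan_inv; auto|].
  apply cspan_conj; auto; apply subV; auto.
Qed.

(** ** Abelianization of rank at most one *)

Section RankOne.
Hypothesis minors : forall i j, (ab g i * ab f j = ab g j * ab f i)%Z.

Lemma rank1_generator :
  exists t, H t /\ forall h, H h -> exists m, forall i, ab h i = (m * ab t i)%Z.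
Proof.
destruct (classic (forall i, ab g i = 0 /\ ab f i = 0)%Z) as [Z0|Z0].
- exists gone; split; [apply (sub1 H sH)|intros h Hh; exists 0%Z; intros i].
  destruct (gen2_ab h Hh) as (p & q & ->); destruct (Z0 i) as [-> ->]; lia.
- apply not_all_ex_not in Z0; destruct Z0 as [i0 Z0].
  destruct (Z.gcd_bezout (ab g i0) (ab f i0) _ eq_refl) as (u & v & B).
  set (d := Z.gcd (ab g i0) (ab f i0)) in *.
  assert (d0 : d <> 0%Z) by (intros E; apply Z0, Z.gcd_eq_0; exact E).
  destruct (Z.gcd_divide_l (ab g i0) (ab f i0)) as [m' Em].
  destruct (Z.gcd_divide_r (ab g i0) (ab f i0)) as [n' En]; fold d in Em, En.
  (* By Bezout this element has coordinate d at [i0]. *)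
  exists (zpow g u ** zpow f v); split.
  { apply subM; auto; apply zpow_sub; auto; [apply gen2_l|apply gen2_r]. }
  intros h Hh; destruct (gen2_ab h Hh) as (p & q & E).
  (* The quotients of the [i0] coordinates of g and f by d are m' and n'. The vanishing minors carry
     the identity over to every other coordinate. *)
  exists (p * m' + q * n')%Z; intros i; rewrite E, ab_mul, !ab_zpow.
  apply (Z.mul_reg_l _ _ d d0).
  transitivity ((p * (m' * d) + q * (n' * d)) * (u * ab g i + v * ab f i))%Z; [|ring].
  rewrite <- Em, <- En, <- B; ring [(minors i0 i)].
Qed.

Lemma rank1_factor t h m : H t -> H h -> (forall i, ab h i = (m * ab t i)%Z) ->
  exists n, N n /\ h = n ** zpow t m.
Proof.
intros Ht Hh E; exists (h ** (zpow t m)^-1); split; [|grp].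
apply vclosed_ab_eq0.
- apply subM; auto; apply subV; auto; apply zpow_sub; auto.
- intros i; rewrite ab_mul, ab_inv, ab_zpow, E; lia.
Qed.

(** Elements of H are powers of t modulo H', and powers of t commute; expanding a commutator leaves
    conjugates of commutators with one argument in H'. *)
Lemma rank1_lcs n : N n -> lcs H 2 n.
Proof.
destruct rank1_generator as (t & Ht & Gt).
assert (s2 : subgroup (lcs H 2)) by apply gen_subgroup.
assert (n2 := lcs_normal H 2 sH).
assert (Htm : forall m, H (zpow t m)) by (intros; apply zpow_sub; auto).
apply gen_min; auto; intros _ (a & b & Ha & Hb & ->).
destruct (Gt a Ha) as [m Em]; destruct (rank1_factor t a m Ht Ha Em) as (n1 & N1 & ->).
destruct (Gt b Hb) as [m' Em']; destruct (rank1_factor t b m' Ht Hb Em') as (n2' & N2 & ->).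
rewrite commMg; apply subM; auto.
- apply n2; [apply subV; auto|]; apply mutual_comm_in; auto.
- rewrite commgM, (commute_comm (zpow t m) (zpow t m')), gmul1.
  + apply n2; [apply subV; auto|]; rewrite <- invg_comm; apply subV; auto.
    apply mutual_comm_in; auto.
  + rewrite <- !zpowD; f_equal; lia.
Qed.

Lemma rank1_retract : (forall n, N n -> n = gone) -> retract H.
Proof.
intros N1; destruct rank1_generator as (t & Ht & Gt).
destruct (verb_closed_hom g f vc t Ht) as (phi & phiM & phiH & E).
exists phi; split; [auto|split; auto].
intros h Hh; destruct (Gt h Hh) as [m Em].
destruct (rank1_factor t h m Ht Hh Em) as (n & Nn & ->).
rewrite (N1 n Nn), gmul1, (hom_zpow phi), E; auto.
Qed.

End RankOne.

(** ** Abelianization of rank two *)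

Section RankTwo.
Context (phi : G -> G) (phiM : is_hom phi) (i0 j0 : nat) (p q s u : Z).
Hypothesis phiH : forall y, H (phi y).
Hypothesis minor : (ab g i0 * ab f j0 - ab g j0 * ab f i0 <> 0)%Z.
Hypothesis phi_g : forall i, ab (phi g) i = (p * ab g i + q * ab f i)%Z.
Hypothesis phi_f : forall i, ab (phi f) i = (s * ab g i + u * ab f i)%Z.
Hypothesis det1 : (p * u - q * s = 1)%Z.

(** Cramer's rule in the coordinates [i0] and [j0]. *)
Lemma ab_indep a b : (forall i, a * ab g i + b * ab f i = 0)%Z -> a = 0%Z /\ b = 0%Z.
Proof.
intros E; assert (Ei := E i0); assert (Ej := E j0); split.
- apply (Z.mul_eq_0_l _ _ ) with (2 := minor).
  transitivity ((a * ab g i0 + b * ab f i0) * ab f j0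
    - (a * ab g j0 + b * ab f j0) * ab f i0)%Z; [ring|rewrite Ei, Ej; ring].
- apply (Z.mul_eq_0_l _ _ ) with (2 := minor).
  transitivity ((a * ab g j0 + b * ab f j0) * ab g i0
    - (a * ab g i0 + b * ab f i0) * ab g j0)%Z; [ring|rewrite Ei, Ej; ring].
Qed.

Lemma phi_ab h : H h -> exists a b,
  (forall i, ab h i = a * ab g i + b * ab f i)%Z /\
  (forall i, ab (phi h) i = (a * p + b * s) * ab g i + (a * q + b * u) * ab f i)%Z.
Proof.
revert h; apply (gen2_min g f (fun h => exists a b,
  (forall i, ab h i = a * ab g i + b * ab f i)%Z /\
  (forall i, ab (phi h) i = (a * p + b * s) * ab g i + (a * q + b * u) * ab f i)%Z)).
- split.
  + exists 0%Z, 0%Z; split; intros i; rewrite ?(hom1 phi), ab_one by auto; ring.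
  + intros h h' (a & b & E & F) (a' & b' & E' & F').
    exists (a + a')%Z, (b + b')%Z; split; intros i.
    * rewrite ab_mul, E, E'; ring.
    * rewrite phiM, ab_mul, F, F'; ring.
  + intros h (a & b & E & F); exists (- a)%Z, (- b)%Z; split; intros i.
    * rewrite ab_inv, E; ring.
    * rewrite (homV phi), ab_inv, F by auto; ring.
- exists 1%Z, 0%Z; split; intros i; [|rewrite phi_g]; ring.
- exists 0%Z, 1%Z; split; intros i; [|rewrite phi_f]; ring.
Qed.

Lemma phi_ab_inj h : H h -> (forall i, ab (phi h) i = 0%Z) -> forall i, ab h i = 0%Z.
Proof.
intros Hh E; destruct (phi_ab h Hh) as (a & b & F & F').
destruct (ab_indep (a * p + b * s) (a * q + b * u)) as [A B].
{ intros i; rewrite <- F'; apply E. }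
assert (a = 0%Z).
{ transitivity ((a * p + b * s) * u - (a * q + b * u) * s)%Z;
    [transitivity (a * (p * u - q * s))%Z; [rewrite det1|]; ring|rewrite A, B; ring]. }
assert (b = 0%Z).
{ transitivity ((a * q + b * u) * p - (a * p + b * s) * q)%Z;
    [transitivity (b * (p * u - q * s))%Z; [rewrite det1|]; ring|rewrite A, B; ring]. }
subst; intros i; rewrite F; ring.
Qed.

Lemma phi_ab_surj h : H h -> exists h', H h' /\ forall i, ab (phi h') i = ab h i.
Proof.
intros Hh; destruct (gen2_ab h Hh) as (a & b & E).
(* The exponents are the row (a, b) times the inverse of the matrix with rows (p, q) and (s, u). *)
exists (zpow g (a * u - b * s) ** zpow f (b * p - a * q)); split.
- apply subM; auto; apply zpow_sub; auto; [apply gen2_l|apply gen2_r].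
- intros i; rewrite phiM, ab_mul, !(hom_zpow phi), !ab_zpow, phi_g, phi_f, E by auto.
  transitivity ((p * u - q * s) * (a * ab g i + b * ab f i))%Z; [ring|rewrite det1; ring].
Qed.

(** * Rank two with a torsion-free derived module *)

Section MetabelianCase.
Hypothesis phi_comm : phi (comm g f) = comm g f.
Hypothesis torsion_free : forall (k : G -> G) (l : list (Z * G)),
  lprod (fun y => conjg (k y) (comm g f)) l = gone ->
  forall a, coef (fun y => ab (k y) : vec) l a = 0%Z.

(** The conjugators differ by an element of G', which acts trivially on the abelian group G'. *)
Lemma conj_comm_ab h h' : (forall i, ab h i = ab h' i) ->
  conjg h (comm g f) = conjg h' (comm g f).
Proof.
intros E; replace h with (h' ** (h'^-1 ** h)) by grp.
rewrite conjgM; f_equal; apply commute_conj, der_abelian; auto.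
- apply ab_eq0_der; intros i; rewrite ab_mul, ab_inv, E; lia.
- apply mutual_comm_in; auto.
Qed.

Lemma rank2_surj h : H h -> exists h', H h' /\ phi h' = h.
Proof.
assert (sI : subgroup (fun h => exists h', H h' /\ phi h' = h)).
{ split.
  - exists gone; split; [apply (sub1 H sH)|apply hom1; auto].
  - intros _ _ (a & Ha & <-) (b & Hb & <-); exists (a ** b); split; [apply subM|]; auto.
  - intros _ (a & Ha & <-); exists (a^-1); split; [apply subV|apply homV]; auto. }
intros Hh; destruct (phi_ab_surj h Hh) as (h1 & H1 & E1).
replace h with (h ** (phi h1)^-1 ** phi h1) by grp.
apply (subM _ sI); [|eauto].
(* The remaining factor lies in H', so only the conjugates of [g,f] need preimages; phi fixes [g,f],
   and each conjugator matters only through its image under [ab]. *)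
destruct (der_gen2_cspan (h ** (phi h1)^-1)) as (_ & l & Hl & _ & ->).
{ apply vclosed_ab_eq0; [apply subM; auto; apply subV; auto|].
  intros i; rewrite ab_mul, ab_inv, E1; lia. }
apply (lprod_sub (fun h => exists h', H h' /\ phi h' = h)); auto.
intros e y I; destruct (phi_ab_surj y (Hl e y I)) as (y1 & Hy1 & Ey1).
exists (conjg y1 (comm g f)); split.
- apply sub_conj, sub_comm; auto using gen2_l, gen2_r.
- rewrite (hom_conj phi), phi_comm by auto; apply conj_comm_ab; auto.
Qed.

(** A kernel element is a product of conjugates of [g,f]. Applying phi replaces each conjugator y by
    [phi y], so torsion-freeness kills the coefficients keyed by [ab (phi y)]. Equal keys come from
    equal [ab y], hence from equal conjugates, so the original product is trivial. *)
Lemma rank2_inj h : H h -> phi h = gone -> h = gone.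
Proof.
intros Hh E; destruct (der_gen2_cspan h) as (_ & l & Hl & _ & El).
{ apply vclosed_ab_eq0; auto; apply phi_ab_inj; auto; intros i; rewrite E; apply ab_one. }
rewrite El in E |- *; rewrite (hom_lprod phi) in E by auto.
rewrite (lprod_ext _ (fun y => conjg (phi y) (comm g f))) in E
  by (intros; rewrite (hom_conj phi), phi_comm; auto).
apply (lprod_coef0 (der G)) with (key := fun y => ab (phi y) : vec).
- apply gen_subgroup.
- apply der_abelian; auto.
- intros; apply conj_comm_der.
- intros e y e' y' I I' K; apply conj_comm_ab; intros i.
  cut (ab (y ** y'^-1) i = 0%Z); [rewrite ab_mul, ab_inv; lia|].
  apply phi_ab_inj; [apply subM; eauto; apply subV; eauto|].
  intros j; rewrite phiM, (homV phi), ab_mul, ab_inv, K by auto; lia.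
- apply torsion_free; auto.
Qed.

End MetabelianCase.

(** The inverse matrix need not come from an endomorphism of H known beforehand, but freeness of G
    allows phi to be followed by it on the basis, modulo H'. *)
Lemma rank2_unipotent : exists psi : G -> G,
  is_hom psi /\ (forall y, H (psi y)) /\ forall h, H h -> N (psi h ** h^-1).
Proof.
assert (C : forall i, exists ab2 : Z * Z,
  forall j, ab (phi (x i)) j = (fst ab2 * ab g j + snd ab2 * ab f j)%Z).
{ intros i; destruct (gen2_ab (phi (x i)) (phiH _)) as (a & b & E); exists (a, b); auto. }
apply choice in C; destruct C as [A EA].
destruct (hom_into H (fun i => zpow g (fst (A i) * u - snd (A i) * s) **
  zpow f (snd (A i) * p - fst (A i) * q))) as (psi & psiM & psix & psiH); auto.
{ intros; apply subM; auto; apply zpow_sub; auto; [apply gen2_l|apply gen2_r]. }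
exists psi; repeat split; auto.
(* The relation between phi and psi holds on the basis by construction and extends to words. *)
assert (P : forall y, exists a b,
  (forall i, ab (phi y) i = a * ab g i + b * ab f i)%Z /\
  (forall i, ab (psi y) i = (a * u - b * s) * ab g i + (b * p - a * q) * ab f i)%Z).
{ intros y; destruct (word_of y) as [w <-].
  apply (weval_sub (fun y => exists a b,
    (forall i, ab (phi y) i = a * ab g i + b * ab f i)%Z /\
    (forall i, ab (psi y) i = (a * u - b * s) * ab g i + (b * p - a * q) * ab f i)%Z)).
  - split.
    + exists 0%Z, 0%Z; split; intros i; rewrite ?(hom1 phi), ?(hom1 psi), ab_one by auto; ring.
    + intros h h' (a & b & E & F) (a' & b' & E' & F').
      exists (a + a')%Z, (b + b')%Z; split; intros i.
      * rewrite phiM, ab_mul, E, E'; ring.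
      * rewrite psiM, ab_mul, F, F'; ring.
    + intros h (a & b & E & F); exists (- a)%Z, (- b)%Z; split; intros i.
      * rewrite (homV phi), ab_inv, E by auto; ring.
      * rewrite (homV psi), ab_inv, F by auto; ring.
  - intros n; unfold basis_assign; destruct (Nat.ltb_spec n r).
    + exists (fst (A n)), (snd (A n)); split; auto.
      intros i; rewrite psix, ab_mul, !ab_zpow by auto; reflexivity.
    + exists 0%Z, 0%Z; split; intros i; rewrite ?(hom1 phi), ?(hom1 psi), ab_one by auto; ring. }
assert (Q : forall h, H h -> forall i, ab (psi h) i = ab h i).
{ intros h Hh i; destruct (phi_ab h Hh) as (a & b & E & F); destruct (P h) as (a' & b' & E' & F').
  destruct (ab_indep (a' - (a * p + b * s)) (b' - (a * q + b * u))) as [Ea Eb].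
  { intros j; specialize (F j); specialize (E' j); rewrite E' in F.
    transitivity (a' * ab g j + b' * ab f j -
      ((a * p + b * s) * ab g j + (a * q + b * u) * ab f j))%Z; [ring|lia]. }
  apply Zminus_eq in Ea, Eb; rewrite F', Ea, Eb, E.
  transitivity ((p * u - q * s) * (a * ab g i + b * ab f i))%Z; [ring|rewrite det1; ring]. }
intros h Hh; apply vclosed_ab_eq0; [apply subM; auto; apply subV; auto|].
intros i; rewrite ab_mul, ab_inv, Q by auto; lia.
Qed.

End RankTwo.

(** ** Nilpotent groups *)

Section Nilpotent.
Lemma lcomm_ext (a b : nat -> G) j : (forall i, i <= j -> a i = b i) -> lcomm a j = lcomm b j.
Proof.
induction j; simpl; intros E; [apply E; auto|].
rewrite IHj, E; auto.
Qed.

Lemma commMg_der a b h : der G a -> der G b -> comm (a ** b) h = comm a h ** comm b h.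
Proof.
intros Da Db; rewrite commMg; f_equal; apply commute_conj, der_abelian; auto.
- apply gen_inv; auto.
- apply mutual_comm_in; auto.
Qed.

(** This links the subgroup series to the law in [nilpotent_le]: inside G' commutators are
    multiplicative in the first argument, so left-normed ones generate. *)
Lemma lcs_lcomm j a : lcs H (S j) a -> gen (fun z => exists s, z = lcomm s (S j)) a.
Proof.
revert a; induction j; intros a; (apply gen_min; [apply gen_subgroup|]).
- intros _ (b & h & _ & _ & ->); apply gen_in.
  exists (fun i => match i with 0 => b | _ => h end); reflexivity.
- intros _ (b & h & Lb & _ & ->); apply IHj in Lb.
  assert (D : forall b, gen (fun z => exists s, z = lcomm s (S j)) b -> der G b).
  { apply gen_min; [apply gen_subgroup|].
    intros _ [s ->]; apply mutual_comm_in; auto. }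
  induction Lb as [b [s ->]| |b b' Lb IHb Lb' IHb'|b Lb IHb].
  + apply gen_in; exists (fun i => if i <=? S j then s i else h).
    change (comm (lcomm s (S j)) h = comm (lcomm (fun i => if i <=? S j then s i else h) (S j))
      (if S (S j) <=? S j then s (S (S j)) else h)).
    destruct (Nat.leb_spec (S (S j)) (S j)); [lia|]; f_equal; apply lcomm_ext.
    intros i li; destruct (Nat.leb_spec i (S j)); auto; lia.
  + replace (comm gone h) with (gone : G) by grp; apply gen_one.
  + rewrite commMg_der; auto; apply gen_mul; auto.
  + replace (comm (b^-1) h) with ((comm b h)^-1); [apply gen_inv; auto|].
    symmetry; apply invg_unique.
    rewrite <- commMg_der; [rewrite mulgV; grp|auto|apply gen_inv, D, Lb].
Qed.

Context (k : nat) (k1 : 1 <= k) (nil : nilpotent_le k G).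

Lemma lcs_trivial a : lcs H k a -> a = gone.
Proof.
assert (Ek : k = S (pred k)) by lia; rewrite Ek; intros L; apply lcs_lcomm in L; revert a L.
apply (gen_min _ (fun a => a = gone)).
- split; auto; intros; subst; grp.
- intros _ [s ->]; rewrite <- Ek; apply nil.
Qed.

(** Iterating H' = [H',H] pushes H' down to the trivial term of the series. *)
Lemma nilpotent_perfect : (forall n, N n -> lcs H 2 n) -> forall n, N n -> n = gone.
Proof.
intros N2.
assert (L : forall j n, N n -> lcs H (S j) n).
{ induction j; auto; intros n Nn; apply N2 in Nn; revert n Nn.
  apply gen_min; [apply gen_subgroup|]; intros _ (a & h & Na & Hh & ->).
  apply mutual_comm_in; auto; apply IHj; auto. }
intros n Nn; apply lcs_trivial.
replace k with (S (pred k)) by lia; apply L; auto.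
Qed.

Context (psi : G -> G) (psiM : is_hom psi).
Hypothesis psiH : forall y, H (psi y).
Hypothesis psi_unip : forall h, H h -> N (psi h ** h^-1).

(** Write psi a = e a and psi h = n h, with e one term deeper than a and n in H'. Expanding
    [e a, n h] leaves [a,h] times conjugates of [e, n h] and [a,n], which lie deep enough. *)
Lemma unipotent_lcs j a : lcs H j a -> lcs H (S j) (psi a ** a^-1).
Proof.
revert a; induction j; auto; intros a La.
assert (sL : subgroup (lcs H (S (S j)))) by apply gen_subgroup.
assert (nL := lcs_normal H (S (S j)) sH).
induction La as [z (a & h & La & Hh & ->)| |a b La IHa Lb IHb|a La IHa].
- assert (Ha : H a) by (apply (lcs_sub H j); auto).
  assert (e1 := IHj a La); assert (n1 := psi_unip h Hh).
  set (e := psi a ** a^-1) in *; set (n := psi h ** h^-1) in *.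
  replace (psi (comm a h)) with (comm (e ** a) (n ** h))
    by (rewrite (hom_comm psi) by auto; f_equal; unfold e, n; grp).
  assert (Hn : H n) by (apply (lcs_sub H 1); auto).
  rewrite commMg, (commgM n h a), !mulgA_r; apply subM; auto.
  { apply nL; [apply subV; auto|]; apply mutual_comm_in; auto; apply subM; auto. }
  rewrite gmulA; apply (nL (comm a h)); [apply sub_comm; auto|].
  apply nL; [apply subV; auto|].
  (* For a in H, [a,n] lies in [H',H]. On later terms a and n both lie in the abelian G', so [a,n] =
     1. *)
  destruct j as [|j].
  + rewrite <- invg_comm; apply subV; auto; apply mutual_comm_in; auto.
  + rewrite commute_comm; [apply (sub1 _ sL)|].
    apply der_abelian; auto; eapply lcs_der; eauto.
- rewrite (hom1 psi) by auto; rewrite mulgV; apply (sub1 _ sL).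
- rewrite psiM.
  replace (psi a ** psi b ** (a ** b)^-1) with (conjg (psi a) (psi b ** b^-1) ** (psi a ** a^-1))
    by (unfold conjg; grp).
  apply subM; auto.
- rewrite (homV psi) by auto.
  replace ((psi a)^-1 ** a^-1^-1) with (conjg ((psi a)^-1) ((psi a ** a^-1)^-1))
    by (unfold conjg; grp).
  apply nL; apply subV; auto.
Qed.

(** With psi h = 1, unipotence moves h one term deeper, indefinitely. *)
Lemma unipotent_inj h : H h -> psi h = gone -> h = gone.
Proof.
intros Hh E; apply lcs_trivial.
assert (L : forall j, lcs H j h); auto; induction j; auto.
apply unipotent_lcs in IHj; rewrite E, gmul1 in IHj.
rewrite <- (invgK h); apply subV; auto; apply gen_subgroup.
Qed.

Lemma unipotent_surj y : H y -> exists h, H h /\ psi h = y.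
Proof.
assert (S : forall m j y, m + j = k -> lcs H j y -> exists h, H h /\ psi h = y).
{ induction m; simpl; intros j z E Lz.
  - subst j; rewrite (lcs_trivial z Lz); exists gone; split; [apply (sub1 H sH)|apply hom1; auto].
  - destruct (IHm (S j) (psi z ** z^-1)) as (h & Hh & Eh); [lia|apply unipotent_lcs; auto|].
    (* As psi h = psi(z) z^-1, this element is mapped to z; h comes from the next term of the
       series, the induction going up from the trivial one. *)
    exists (h^-1 ** z); split.
    + apply subM; auto; [apply subV; auto|apply (lcs_sub H j); auto].
    + rewrite psiM, (homV psi), Eh by auto; grp. }
apply (S k 0); lia.
Qed.

End Nilpotent.

End RelFree.

(** * The equivalence *)

Lemma nilpotent_le_mono j k (M : group) : j <= k -> nilpotent_le j M -> nilpotent_le k M.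
Proof.
induction 1 as [|k _ IH]; auto; intros nM s; simpl; rewrite (IH nM s); grp.
Qed.

Section Free.
Context (V : group -> Prop) (r : nat) (G : group) (x : nat -> G).
Hypothesis free : rel_free V r G x.
Hypothesis V_class2 : forall M, metabelian M -> nilpotent_le 2 M -> V M.

Lemma abelianization_exists :
  exists ab : G -> vgrp, is_hom ab /\ forall i, i < r -> ab (x i) = vdelta i.
Proof.
destruct free as (_ & _ & ext); destruct vgrp_class2 as [mv nv].
exact (ext vgrp (V_class2 _ mv nv) vdelta).
Qed.

Context (ab : G -> vgrp) (abM : is_hom ab).
Hypothesis ab_x : forall i, i < r -> ab (x i) = vdelta i.

(* [zeta] is the central coordinate of a homomorphism to the Heisenberg group. *)
Lemma comm_minor i j : exists zeta : G -> Z, zeta gone = 0%Z /\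
  forall a b, zeta (comm a b) = (ab a i * ab b j - ab b i * ab a j)%Z.
Proof.
assert (ext := proj2 (proj2 free)); destruct heis_class2 as [mh nh].
destruct (ext heis (V_class2 _ mh nh) (fun l => (vdelta l i, vdelta l j, 0%Z)))
  as (eta & etaM & etax).
assert (E1 : forall y, fst (fst (eta y)) = ab y i).
{ apply (hom_ext V r G x free (M := Zgrp) (fun y => fst (fst (eta y))) (fun y => ab y i)).
  - intros a b; rewrite etaM; destruct (eta a) as [[? ?] ?], (eta b) as [[? ?] ?]; reflexivity.
  - intros a b; rewrite abM; reflexivity.
  - intros l ll; rewrite etax, ab_x; auto. }
assert (E2 : forall y, snd (fst (eta y)) = ab y j).
{ apply (hom_ext V r G x free (M := Zgrp) (fun y => snd (fst (eta y))) (fun y => ab y j)).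
  - intros a b; rewrite etaM; destruct (eta a) as [[? ?] ?], (eta b) as [[? ?] ?]; reflexivity.
  - intros a b; rewrite abM; reflexivity.
  - intros l ll; rewrite etax, ab_x; auto. }
exists (fun y => snd (eta y)); split.
- rewrite (hom1 eta) by auto; reflexivity.
- intros a b; rewrite (hom_comm eta), comm_heis, !E1, !E2 by auto; reflexivity.
Qed.

Context (g f : G).
Hypothesis mG : metabelian G.
Hypothesis vc : verb_closed (gen2 g f).

Hypothesis cases :
  (exists k, 1 <= k /\ nilpotent_le k G) \/
  (forall (k : G -> G) (c : G) (l : list (Z * G)),
    ab c = vzero -> c <> gone -> lprod (fun y => conjg (k y) c) l = gone ->
    forall a, coef (fun y => ab (k y) : vec) l a = 0%Z).

Lemma verb_closed_retract : retract (gen2 g f).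
Proof.
assert (ab_comm : ab (comm g f) = vzero).
{ apply der_ab_eq0; auto; apply mutual_comm_in; auto. }
destruct (classic (forall i j, (ab g i * ab f j = ab g j * ab f i)%Z)) as [minors|minors].
- apply (rank1_retract V r G x free ab abM ab_x g f vc minors).
  assert (L2 := rank1_lcs V r G x free ab abM ab_x g f vc minors).
  destruct cases as [(k & k1 & nil)|tf].
  + exact (nilpotent_perfect G mG g f k k1 nil L2).
  + assert (c1 : comm g f = gone).
    { apply NNPP; intros c1.
      destruct (lcs2_cspan G mG g f (comm g f)) as (l & _ & l0 & El).
      { apply L2, mutual_comm_in; [apply gen2_l|apply gen2_r]. }
      (* From [g,f] in [H',H], the element 1 - l annihilates [g,f] while its augmentation is 1;
         torsion-freeness would force that augmentation to be 0. *)
      assert (W : wsum ((1%Z, gone) :: nlist l) = 0%Z).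
      { apply (wsum_coef0 (fun y : G => ab y : vec)).
        apply (tf (fun y => y) (comm g f)); auto.
        simpl; rewrite zpow1, (lprod_nlist (der G)), <- El.
        - unfold conjg; grp.
        - apply gen_subgroup.
        - apply der_abelian; auto.
        - intros; apply conj_comm_der. }
      change (1 + wsum (nlist l) = 0)%Z in W; rewrite wsum_nlist, l0 in W; discriminate W. }
    intros n Nn; destruct (der_gen2_cspan G mG g f n Nn) as (_ & l & _ & _ & ->).
    apply (lprod_sub (fun a => a = gone)); [split; auto; intros; subst; grp|].
    intros; rewrite c1; apply conjg1.
- apply not_all_ex_not in minors; destruct minors as [i0 minors].
  apply not_all_ex_not in minors; destruct minors as [j0 minors].
  assert (minor : (ab g i0 * ab f j0 - ab g j0 * ab f i0 <> 0)%Z) by lia; clear minors.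
  assert (Hg := gen2_l g f); assert (Hf := gen2_r g f); assert (sH := gen2_subgroup g f).
  destruct (verb_closed_hom V r G x free g f vc (comm g f)) as (phi & phiM & phiH & E).
  { apply sub_comm; auto. }
  destruct (gen2_ab G ab abM g f (phi g) (phiH g)) as (p & q & Eg).
  destruct (gen2_ab G ab abM g f (phi f) (phiH f)) as (s & u & Ef).
  destruct (comm_minor i0 j0) as (zeta & z1 & zc).
  (* Applying phi multiplies the minor of g and f by the determinant, yet [zeta] takes the same
     value since phi fixes [g,f]. *)
  assert (det1 : (p * u - q * s = 1)%Z).
  { assert (Z := f_equal zeta E); rewrite (hom_comm phi), !zc, !Eg, !Ef in Z by auto.
    apply (Z.mul_reg_r _ _ _ minor); lia. }
  destruct cases as [(k & k1 & nil)|tf].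
  + destruct (rank2_unipotent V r G x free ab abM ab_x g f vc phi phiM i0 j0 p q s u
      phiH minor Eg Ef det1) as (psi & psiM & psiH & unip).
    apply (retract_of_bij G _ psi); auto.
    * apply (unipotent_surj G mG g f k k1 nil psi); auto.
    * apply (unipotent_inj G mG g f k k1 nil psi); auto.
  + assert (c1 : comm g f <> gone).
    { intros c1; assert (Z := zc g f); rewrite c1, z1 in Z; lia. }
    apply (retract_of_bij G _ phi); auto.
    * eapply rank2_surj; eauto.
    * eapply rank2_inj; eauto.
Qed.

End Free.

(** The retraction fixes the constants and carries a solution in G to one in H. *)
Lemma retract_alg_closed (G : group) (H : G -> Prop) : retract H -> alg_closed H.
Proof.
intros (phi & phiM & phiH & fix_H) sys cst (a & sol).
exists (fun n => phi (a n)); split; auto.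
rewrite Forall_forall in *; intros t It; rewrite <- (hom1 phi phiM), <- (sol t It).
specialize (cst t It); clear It; induction t as [n|c| |t1 IH1 t2 IH2|t IH]; simpl in *.
- reflexivity.
- unfold id; symmetry; auto.
- symmetry; apply hom1; auto.
- rewrite phiM, IH1, IH2; tauto.
- rewrite (homV phi), IH; auto.
Qed.

Fixpoint embed_word (C : Type) (w : term Empty_set) : term C :=
  match w with
  | TVar n => TVar n
  | TCst e => match e with end
  | TOne => TOne
  | TMul w1 w2 => TMul (embed_word C w1) (embed_word C w2)
  | TInv w1 => TInv (embed_word C w1)
  end.

Lemma eval_embed_word {G : group} {C : Type} (c : C -> G) a w :
  eval c a (embed_word C w) = weval a w.
Proof.
induction w as [n|[]| |w1 IH1 w2 IH2|w IH]; unfold weval in *; simpl; congruence.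
Qed.

(** The equation w = h is the one-equation system w h^-1 = 1 with constant h. *)
Lemma alg_closed_verb_closed (G : group) (H : G -> Prop) : alg_closed H -> verb_closed H.
Proof.
intros ac w h Hh; split; [intros [a E]|intros (a & _ & E); eauto].
destruct (ac [TMul (embed_word G w) (TInv (TCst h))]) as (b & Hb & sol).
- constructor; auto; simpl; split; auto.
  clear E; induction w as [n|[]| |w1 IH1 w2 IH2|w IH]; simpl; auto.
- exists a; constructor; auto; simpl; rewrite eval_embed_word, E; apply mulgV.
- exists b; split; auto; inversion sol as [|? ? S _]; simpl in S.
  rewrite eval_embed_word in S; apply mulg_eq1; exact S.
Qed.

Theorem theorem4p1 (r k : nat) (Hr : 2 <= r) (Hk : 4 <= k)
  (G : group) (x : nat -> G)
  (HG : rel_free metabelian r G x \/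
        rel_free (fun M => metabelian M /\ nilpotent_le k M) r G x)
  (g f : G) :
  (retract (gen2 g f) <-> alg_closed (gen2 g f)) /\
  (alg_closed (gen2 g f) <-> verb_closed (gen2 g f)).
Proof.
assert (VR : verb_closed (gen2 g f) -> retract (gen2 g f)).
{ intros vc; destruct HG as [free|free].
  - assert (mG : metabelian G) by apply free.
    destruct (abelianization_exists _ _ _ _ free) as (ab & abM & ab_x); auto.
    destruct (proj2 (proj2 free) magnus magnus_metabelian magnus_gen) as (mu & muM & mu_x).
    apply (verb_closed_retract metabelian r G x free) with (ab := ab); auto.
    right; intros h c l; eapply der_torsion_free; eauto.
  - assert (VG := proj1 free); simpl in VG; destruct VG as [mG nG].
    (* The targets used, the vector group and the Heisenberg group, have class at most 2, hence at
       most k. *)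
    assert (class2 : forall M, metabelian M -> nilpotent_le 2 M ->
      metabelian M /\ nilpotent_le k M).
    { intros M mM nM; split; auto; apply (nilpotent_le_mono 2); auto; lia. }
    destruct (abelianization_exists _ _ _ _ free) as (ab & abM & ab_x); auto.
    apply (verb_closed_retract _ r G x free) with (ab := ab); auto.
    left; exists k; split; auto; lia. }
assert (RA := retract_alg_closed G (gen2 g f)).
assert (AV := alg_closed_verb_closed G (gen2 g f)).
tauto.
Qed.
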